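(* For each of the five pairs $S\in\{(P_2,P_4),\,(P_2,P_5),\,(P_3,P_4),\,(P_3,P_5),\,(P_4,P_5)\}$, as formal power series in $x$, $$\sum_{n\ge 0}|\mathcal{M}_n(S)|\,x^n=\frac{1-2x}{1-3x+x^2}.$$ Moreover, $|\mathcal{M}_n(S)|=F_{2n-1}$ for all $n\ge 1$, where $F_m$ denotes the $m$-th Fibonacci number.
   Context: A matching with $n$ arcs is a partition of $\{1,2,\ldots,2n\}$ into blocks of size 2, called arcs; an arc is written $[a,b]$ with $a<b$, where $a$ is its opener and $b$ its closer. For $n=0$ there is exactly one (empty) matching. A matching is Stoimenow if it contains no pair of arcs $[i,\ell],[i+1,k]$ with $i+1<k<\ell$ (Type 1) and no pair of arcs $[k,j+1],[\ell,j]$ with $k<\ell<j$ (Type 2). A matching $M$ contains a pattern (a matching) $P$ with $m$ arcs if some $m$ arcs of $M$ become $P$ after their $2m$ endpoints are relabelled $1,\ldots,2m$ in the order-preserving way; otherwise $M$ avoids $P$. $\mathcal{M}_n(S)$ denotes the set of Stoimenow matchings with $n$ arcs avoiding every pattern in $S$. The patterns are $P_2=\{[1,3],[2,5],[4,7],[6,8]\}$, $P_3=\{[1,2],[3,5],[4,6],[7,8]\}$, $P_4=\{[1,2],[3,5],[4,7],[6,8]\}$, $P_5=\{[1,3],[2,5],[4,6],[7,8]\}$. Fibonacci numbers: $F_0=0$, $F_1=1$, $F_m=F_{m-1}+F_{m-2}$ for $m\ge 2$. *)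

(* Defs.v *)
From mathcomp Require Import all_boot all_order all_algebra.

Set Implicit Arguments.
Unset Strict Implicit.
Unset Printing Implicit Defensive.

Import GRing.Theory.

(* The point x : 'I_n.*2 stands for the element x.+1 of {1, ..., 2n}.         *)
Notation arcset n := {set {set 'I_n.*2}} (only parsing).

Definition is_matching n (M : arcset n) : bool :=
  partition M [set: 'I_n.*2] && [forall B in M, #|B| == 2].

Definition is_arc n (M : arcset n) (a b : 'I_n.*2) : bool :=
  (a < b) && ([set a; b] \in M).

Definition has_type1 n (M : arcset n) : bool :=
  [exists i : 'I_n.*2, exists i1 : 'I_n.*2, exists k : 'I_n.*2,
   exists l : 'I_n.*2,
    [&& i1 == i.+1 :> nat, i1 < k < l, is_arc M i l & is_arc M i1 k]].

Definition has_type2 n (M : arcset n) : bool :=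
  [exists k : 'I_n.*2, exists l : 'I_n.*2, exists j : 'I_n.*2,
   exists j1 : 'I_n.*2,
    [&& j1 == j.+1 :> nat, k < l < j, is_arc M k j1 & is_arc M l j]].

Definition stoimenow n (M : arcset n) : bool :=
  [&& is_matching M, ~~ has_type1 M & ~~ has_type2 M].

(* f is the inverse of the relabelling: it maps the label i to the i-th       *)
(* smallest endpoint of the arcs in A.                                        *)
Definition relabels_to m n (A : arcset n) (P : arcset m) : bool :=
  [exists f : {ffun 'I_m.*2 -> 'I_n.*2},
    [forall i : 'I_m.*2, forall j : 'I_m.*2, (i < j) ==> (f i < f j)] &&
    (A == [set f @: (B : {set 'I_m.*2}) | B in P])].

Definition contains m n (M : arcset n) (P : arcset m) : bool :=
  [exists A : arcset n, [&& A \subset M, #|A| == m & relabels_to A P]].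

Definition avoiders m (S : {set arcset m}) n : {set arcset n} :=
  [set M : arcset n | stoimenow M & [forall P in S, ~~ contains M P]].

Definition of_arcs n (s : seq (nat * nat)) : arcset n :=
  [set:: [seq [set x : 'I_n.*2 | x.+1 \in [:: p.1; p.2]] | p <- s]].

Definition P2 : arcset 4 := of_arcs 4 [:: (1, 3); (2, 5); (4, 7); (6, 8)].
Definition P3 : arcset 4 := of_arcs 4 [:: (1, 2); (3, 5); (4, 6); (7, 8)].
Definition P4 : arcset 4 := of_arcs 4 [:: (1, 2); (3, 5); (4, 7); (6, 8)].
Definition P5 : arcset 4 := of_arcs 4 [:: (1, 3); (2, 5); (4, 6); (7, 8)].

Fixpoint fib (m : nat) : nat :=
  match m with
  | 0 => 0
  | 1 => 1
  | (k.+1 as l).+1 => fib l + fib k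
  end.

Local Open Scope ring_scope.

(* A formal power series is its coefficient sequence nat -> R, compared       *)
(* with =1.                                                                   *)
Section PowerSeries.

Variable R : comUnitRingType.
Implicit Types f g h : nat -> R.

Definition fps_of_poly (p : {poly R}) : nat -> R := fun n => p`_n.

Definition fps_mul f g : nat -> R := fun n => \sum_(i < n.+1) f i * g (n - i)%N.

(* The first n coefficients of f / g, by long division; meaningful when the   *)
(* constant coefficient of g is a unit (see fps_divP).                        *)
Fixpoint fps_div_seq f g (n : nat) : seq R :=
  if n is m.+1 then
    let s := fps_div_seq f g m in
    rcons s ((f m - \sum_(i < m) s`_i * g (m - i)%N) / g 0%N)
  else [::].

Definition fps_div f g : nat -> R := fun n => (fps_div_seq f g n.+1)`_n.

Lemma size_fps_div_seq f g n : size (fps_div_seq f g n) = n.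
Proof. by elim: n => //= n IHn; rewrite size_rcons IHn. Qed.

Lemma nth_fps_div_seq f g n i :
  (i < n)%N -> (fps_div_seq f g n)`_i = fps_div f g i.
Proof.
elim: n => // n IHn; rewrite ltnS leq_eqVlt => /predU1P[-> //|lt_in].
by rewrite /= nth_rcons size_fps_div_seq lt_in IHn.
Qed.

Lemma fps_divE f g n :
  fps_div f g n = (f n - \sum_(i < n) fps_div f g i * g (n - i)%N) / g 0%N.
Proof.
rewrite {1}/fps_div /= nth_rcons size_fps_div_seq ltnn eqxx.
by under eq_bigr => i _ do rewrite nth_fps_div_seq //.
Qed.

Lemma fps_divP f g h :
  g 0%N \is a GRing.unit -> (h =1 fps_div f g) <-> (fps_mul h g =1 f).
Proof.
move=> g0; split=> [hE n | hE n].
  rewrite /fps_mul big_ord_recr /= subnn [in X in _ + X]hE fps_divE divrK //.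
  by under eq_bigr => i _ do rewrite hE; rewrite addrC subrK.
have [k] := ubnP n; elim: k n => // k IHk n le_nk.
rewrite fps_divE -hE /fps_mul big_ord_recr /= subnn.
under [X in _ - X]eq_bigr => i _.
  rewrite -IHk; first over.
  by apply: leq_trans (ltn_ord i) _.
by rewrite addrAC subrr add0r mulrK.
Qed.

End PowerSeries.

(* Main.v *)
Require Import Defs.
From mathcomp Require Import all_boot all_order all_algebra.
From mathcomp Require Import zify.

(* A Stoimenow matching is the same thing as a Fishburn matrix: an upper       *)
(* triangular matrix of naturals without zero rows or columns. The runs of     *)
(* consecutive openers are the rows, the runs of consecutive closers are the   *)
(* columns, and entry (i, j) counts the arcs from row i to column j; inside    *)
(* a run the order of the endpoints is forced.                                 *)
(* Let K be the last index (counting from 0). Avoiding P4 means that for       *)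
(* 0 < i <= i' <= j, nonzero entries (i, j) and (i', j') satisfy j' <= j.      *)
(* Adding P2, P3 or P5 forces every nonzero entry (i, j) with i > 0 to have    *)
(* j = i or j = K, and restricts, independently for each 0 < i < K, the        *)
(* triple (d, e, f) of the entries (i, i), (i, K), (0, i):                     *)
(*   P2, P4: d > 0, e = 0;                                                     *)
(*   P3, P4: (d, e) = (1, 0), or d = 0 and e, f > 0;                           *)
(*   P4, P5: d > 0 and e = f = 0, or d = 0 and e, f > 0.                       *)
(* In each case such triples of a given sum are in bijection with pairs        *)
(* (m, r) of that sum with m > 0, so the matchings are in bijection with       *)
(* sequences of such pairs whose first pair has r = 0. These sequences grow    *)
(* by one unit along a generating tree with the odd Fibonacci rule             *)
(* (2) -> (2)(3), (3) -> (2)(3)(3). The two pairs containing P5 but not P4     *)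
(* follow by reversal, which fixes P2 and P3 and exchanges P4 and P5.          *)

(** [stoimenow_diagram], [diagram_inj] and [diagram_surj] carry the correspondence with matrices.
    [contains_word] turns an occurrence of a pattern into a chain of inequalities between rows and
    columns. Because no row or column is zero, the outer arcs of P3, P4 and P5 come for free, so
    avoiding one of these is a condition on two cells or two arcs ([avoid_P3], [avoid_P4],
    [avoid_P5]). Combining the conditions gives the three local descriptions [avoid_P2P4],
    [avoid_P3P4] and [avoid_P4P5]. [card_avoiders] turns each description into the same set of
    codes. [size_rev_codes] counts these: if s codes have a given positive weight and t of them have
    three children, the next weight has 2s+t and s+t, which is the recurrence of consecutive
    Fibonacci numbers in steps of two. Hence a(n+2) = 3a(n+1) - a(n), which [fps_rev_codes] restates
    as the rational generating function. *)

Set Implicit Arguments.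
Unset Strict Implicit.
Unset Printing Implicit Defensive.

(** * Fishburn matrices and their diagrams *)

Section Rank.
Variables (T : finType) (key : T -> nat).
Definition rank x := #|[set y | key y < key x]|.

Lemma rank_lt x y : (rank x < rank y) = (key x < key y).
Proof.
have mono a b : key a <= key b -> rank a <= rank b.
  move=> ab; apply/subset_leq_card/subsetP=> z; rewrite !inE => za.
  exact: leq_trans za ab.
have [lt_xy|le_yx] := ltnP (key x) (key y); last by apply/negbTE; rewrite -leqNgt mono.
apply/proper_card/properP; split; last by exists x; rewrite inE ?ltnn.
by apply/subsetP=> z; rewrite !inE => /ltn_trans; apply.
Qed.

Lemma rank_ltT x : rank x < #|T|.
Proof.
rewrite -cardsT; apply/proper_card/properP; split; first exact: subsetT.
by exists x; rewrite inE ?ltnn.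
Qed.

End Rank.

(** Arc t is the t-th cell of the list. As the list is sorted, arcs end up numbered by increasing
    opener ([key_lt_oo]). *)
Definition row_of (c : seq (nat * nat)) t := (nth (0, 0) c t).1.
Definition col_of (c : seq (nat * nat)) t := (nth (0, 0) c t).2.

Definition lexle (x y : nat * nat) := (x.1 < y.1) || ((x.1 == y.1) && (x.2 <= y.2)).

Lemma lexle_trans : transitive lexle.
Proof. by move=> [a b] [a' b'] [a'' b'']; rewrite /lexle /=; lia. Qed.

Lemma lexle_anti : antisymmetric lexle.
Proof.
move=> [a b] [a' b']; rewrite /lexle /= => H.
by have [-> ->] : a = a' /\ b = b' by lia.
Qed.

Lemma lexle_total : total lexle.
Proof. by move=> [a b] [a' b']; rewrite /lexle /=; lia. Qed.

Lemma lexle_refl : reflexive lexle.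
Proof. by move=> [a b]; rewrite /lexle /=; lia. Qed.

(* A matrix with rows and columns 0, ..., k.-1 is encoded as the lexicographically *)
(* sorted list of its cells, each repeated as often as its entry says.              *)
Record fishburn (k : nat) (c : seq (nat * nat)) : Prop := Fishburn {
  fishburn_sorted : sorted lexle c;
  fishburn_upper : forall x, x \in c -> x.1 <= x.2 < k;
  fishburn_row : forall v, v < k -> exists j, (v, j) \in c;
  fishburn_col : forall v, v < k -> exists i, (i, v) \in c }.

Section Diagram.
Variables (n : nat) (c : seq (nat * nat)).

(* (t, false) and (t, true) are the opener and the closer of arc t. *)
Definition level (e : 'I_n * bool) := if e.2 then col_of c e.1 else row_of c e.1.
(* Numeric encoding of the lexicographic order on (level, closer?, arc): the openers *)
(* of row v come just before the closers of column v.                               *)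
Definition key (e : 'I_n * bool) := ((level e).*2 + e.2) * n + e.1.

Lemma pos_subproof e : rank key e < n.*2.
Proof. by rewrite (leq_trans (rank_ltT _ _)) // card_prod card_ord card_bool muln2. Qed.

Definition pos e := Ordinal (pos_subproof e).

Definition diagram : {set {set 'I_n.*2}} :=
  [set [set pos (t, false); pos (t, true)] | t : 'I_n].

Lemma key_lt e e' : (key e < key e') =
  [|| level e < level e' | (level e == level e') &&
      ((e.2 < e'.2) || ((e.2 == e'.2) && (e.1 < e'.1)))].
Proof.
rewrite /key; move: (level e) (level e') => l l'.
case: e e' => [t b] [t' b'] /=.
have := ltn_ord t; have := ltn_ord t'; case: b b' => [] [] /=; nia.
Qed.

Lemma pos_lt e e' : (pos e < pos e') = (key e < key e').
Proof. exact: rank_lt. Qed.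

Lemma key_lt_oc t t' : (key (t, false) < key (t', true)) = (row_of c t <= col_of c t').
Proof. by rewrite key_lt /level /=; lia. Qed.

Lemma key_lt_co t t' : (key (t, true) < key (t', false)) = (col_of c t < row_of c t').
Proof. by rewrite key_lt /level /=; lia. Qed.

Lemma key_lt_cc t t' : (key (t, true) < key (t', true)) =
  (col_of c t < col_of c t') || (col_of c t == col_of c t') && (t < t').
Proof. by rewrite key_lt /level /=; lia. Qed.

Lemma key_inj : injective key.
Proof.
move=> e e' ee'; have := key_lt e e'; have := key_lt e' e; rewrite ee' ltnn.
case: e e' {ee'} => [t b] [t' b'] /= H1 H2.
have E : b = b' /\ val t = val t' by case: b b' H1 H2 => [] [] /=; lia.
by case: E => -> /val_inj ->.
Qed.

Lemma pos_inj : injective pos.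
Proof.
move=> e e' ee'; apply: key_inj.
have := pos_lt e e'; have := pos_lt e' e; rewrite ee' ltnn; lia.
Qed.

Lemma pos_surj x : exists e, x = pos e.
Proof.
have /codomP[e] : x \in codom pos; last by exists e.
apply: (inj_card_onto pos_inj).
by rewrite card_prod !card_ord card_bool muln2.
Qed.

(** Used to refute adjacency, with e'' an endpoint supplied by a nonzero row or column. *)
Lemma pos_adjacent e e' e'' : val (pos e') = (pos e).+1 ->
  ~~ ((key e < key e'') && (key e'' < key e')).
Proof. by move=> E; rewrite -!pos_lt E; lia. Qed.

Hypothesis (sz : size c = n).
Variable k : nat.
Hypothesis (fc : fishburn k c).

Lemma lexle_nth (t t' : 'I_n) : t <= t' -> lexle (nth (0, 0) c t) (nth (0, 0) c t').
Proof.
move=> tt'; apply: (sorted_leq_nth lexle_trans lexle_refl _ (fishburn_sorted fc)) => //.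
all: by rewrite inE sz.
Qed.

Lemma row_mono (t t' : 'I_n) : t <= t' -> row_of c t <= row_of c t'.
Proof. by move/lexle_nth; rewrite /lexle /row_of; lia. Qed.

Lemma row_lt (t t' : 'I_n) : row_of c t < row_of c t' -> t < t'.
Proof. by rewrite ltnNge => H; rewrite ltnNge; apply: contra H => /row_mono. Qed.

Lemma col_mono (t t' : 'I_n) :
  row_of c t = row_of c t' -> t <= t' -> col_of c t <= col_of c t'.
Proof. by move=> e /lexle_nth; move: e; rewrite /lexle /row_of /col_of; lia. Qed.

Lemma key_lt_oo (t t' : 'I_n) : (key (t, false) < key (t', false)) = (t < t').
Proof.
rewrite key_lt /level /=; have := @row_mono t t'; have := @row_lt t t'; lia.
Qed.

Lemma cell_index x : x \in c -> exists t : 'I_n, row_of c t = x.1 /\ col_of c t = x.2.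
Proof.
move=> xc; have ltx : index x c < n by rewrite -sz index_mem.
by exists (Ordinal ltx); rewrite /row_of /col_of /= nth_index.
Qed.

Lemma cell_mem (t : 'I_n) : (row_of c t, col_of c t) \in c.
Proof. by rewrite /row_of /col_of -surjective_pairing mem_nth // sz. Qed.

Lemma cell_le (t : 'I_n) : row_of c t <= col_of c t < k.
Proof. exact: (fishburn_upper fc (cell_mem t)). Qed.

Lemma row_onto v : v < k -> exists t : 'I_n, row_of c t = v.
Proof. by case/(fishburn_row fc)=> j /cell_index[t [? _]]; exists t. Qed.

Lemma col_onto v : v < k -> exists t : 'I_n, col_of c t = v.
Proof. by case/(fishburn_col fc)=> j /cell_index[t [_ ?]]; exists t. Qed.

Lemma pos_oc t : pos (t, false) < pos (t, true).
Proof. by rewrite pos_lt key_lt_oc; have /andP[] := cell_le t. Qed.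

Lemma mem_diagram x y : [set x; y] \in diagram -> x < y ->
  exists t, x = pos (t, false) /\ y = pos (t, true).
Proof.
case/imsetP=> t _ /setP E lt_xy; exists t.
have lt_t := pos_oc t.
have := E x; have := E y; have := E (pos (t, true)); have := E (pos (t, false)).
rewrite !inE !eqxx !orbT /= => H1 H2 H3 H4.
have [ex|ex] := eqVneq x (pos (t, false)).
  split=> //; apply/eqP; case/esym/orP: H3 => // /eqP ey.
  by rewrite ex ey ltnn in lt_xy.
move: H4; rewrite (negbTE ex) /= => /esym/eqP ex'.
case/esym/orP: H3 => /eqP ey; last by rewrite ex' ey ltnn in lt_xy.
by move: lt_t; rewrite -ex' -ey; lia.
Qed.

Lemma is_arc_diagram x y : is_arc diagram x y <->
  exists t, x = pos (t, false) /\ y = pos (t, true).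
Proof.
split=> [/andP[lt_xy /mem_diagram]|[t [-> ->]]]; first exact.
by rewrite /is_arc pos_oc; apply/imset_f.
Qed.

Lemma diagram_matching : is_matching diagram.
Proof.
apply/andP; split; last first.
  apply/forall_inP=> B /imsetP[t _ ->]; rewrite cards2.
  by rewrite -val_eqE /= neq_ltn pos_oc.
apply/and3P; split.
- rewrite eqEsubset subsetT; apply/subsetP=> x _.
  have [[t b] ->] := pos_surj x.
  apply/bigcupP; exists [set pos (t, false); pos (t, true)]; first exact: imset_f.
  by case: b; rewrite !inE eqxx ?orbT.
- apply/trivIsetP=> A B /imsetP[t _ ->] /imsetP[t' _ ->] neq.
  apply/pred0P=> x /=; apply/negP=> /andP[]; rewrite !inE.
  have tt' : t != t' by apply: contraNneq neq => ->.
  by case/orP=> /eqP->; rewrite !(inj_eq pos_inj) !xpair_eqE (negbTE tt').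
- apply/imsetP=> -[t _ /setP/(_ (pos (t, false)))].
  by rewrite !inE eqxx.
Qed.

(** Adjacent openers lie in one row, where sortedness orders their closers; in different rows they
    would be separated by a closer of the column indexed by the first row, which is nonzero. Dually,
    closers in different columns are separated by an opener of the row indexed by the later
    column. *)
Lemma stoimenow_diagram : stoimenow diagram.
Proof.
apply/and3P; split; first exact: diagram_matching.
- apply/negP=> /existsP[i /existsP[i1 /existsP[x /existsP[l /and4P[/eqP E /andP[_ lt_xl]]]]]].
  move=> /is_arc_diagram[t [it lt]] /is_arc_diagram[t' [it' lt']]; subst.
  have lt_tt' : t < t' by rewrite -key_lt_oo -pos_lt E.
  move: lt_xl; rewrite pos_lt key_lt_cc => lt_xl.
  have := row_mono (ltnW lt_tt'); rewrite leq_eqVlt => /predU1P[eqr|ltr].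
    by have := col_mono eqr (ltnW lt_tt'); lia.
  have [u cu] : exists u : 'I_n, col_of c u = row_of c t.
    by apply: col_onto; have := cell_le t; lia.
  by move: (pos_adjacent (u, true) E); rewrite key_lt_oc key_lt_co cu leqnn ltr.
- apply/negP=> /existsP[x /existsP[l /existsP[j /existsP[j1 /and4P[/eqP E /andP[lt_xl _]]]]]].
  move=> /is_arc_diagram[t [it lt]] /is_arc_diagram[t' [it' lt']]; subst.
  have lt_tt' : t < t' by rewrite -key_lt_oo -pos_lt.
  have: pos (t', true) < pos (t, true) by rewrite E.
  rewrite pos_lt key_lt_cc.
  case/orP=> [ltc|]; last by lia.
  have [u cu] : exists u : 'I_n, row_of c u = col_of c t.
    by apply: row_onto; have := cell_le t; lia.
  by move: (pos_adjacent (u, false) E); rewrite key_lt_oc key_lt_co cu leqnn ltc.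
Qed.

End Diagram.

(** * Every Stoimenow matching is a diagram *)

Section Levels.
Variables (n : nat) (M : {set {set 'I_n.*2}}).

(** Positions are natural numbers here so that [lev] can recurse on them. *)
Definition opener s := [exists x, exists y, (val x == s) && is_arc M x y].

(* The number of closer-opener descents up to position s: the row of an opener, the *)
(* column of a closer.                                                              *)
Fixpoint lev s := if s is s'.+1 then lev s' + (~~ opener s' && opener s) else 0.

Lemma lev_mono s s' : s <= s' -> lev s <= lev s'.
Proof.
elim: s' => [|s' IH]; first by rewrite leqn0 => /eqP->.
by rewrite leq_eqVlt => /predU1P[->|/IH] //=; lia.
Qed.

(** An opener after a closer raises [lev], so each level is a run of openers followed by a run of
    closers; [closer_run] is the other half. *)
Lemma opener_run s s' : s <= s' -> lev s = lev s' -> opener s' ->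
  forall z, s <= z <= s' -> opener z.
Proof.
elim: s' => [|s' IH] ss' e os' z.
  by move=> ?; have -> : z = 0 by lia.
case/andP=> sz; rewrite leq_eqVlt => /predU1P[->//|zs'].
have m := lev_mono (leq_trans sz (zs' : z <= s')).
have {}e : lev s = lev s' /\ opener s' by move: e; rewrite /= os' andbT; lia.
by apply: (IH _ e.1 e.2); lia.
Qed.

Lemma closer_run s s' : s <= s' -> lev s = lev s' -> ~~ opener s ->
  forall z, s <= z <= s' -> ~~ opener z.
Proof.
elim: s' => [|s' IH] ss' e os z.
  by move=> ?; have -> : z = s by lia.
move: ss'; rewrite leq_eqVlt => /predU1P[ss'|ss'].
  by move=> ?; have -> : z = s by lia.
have m := lev_mono (ss' : s <= s').
have es' : lev s = lev s' by move: e => /=; lia.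
case/andP=> sz; rewrite leq_eqVlt => /predU1P[->|zs']; last by apply: IH; lia.
by move: e; rewrite /= -es' (IH _ es' os s') ?ss' ?leqnn //=; lia.
Qed.

Lemma lev_lt s s' : s < s' -> ~~ opener s -> opener s' -> lev s < lev s'.
Proof.
move=> ss' os os'; rewrite ltn_neqAle lev_mono ?(ltnW ss') // andbT.
apply: contra os => /eqP e; apply: (opener_run (ltnW ss') e os'); lia.
Qed.

(** [lev] rises by at most one, and only on passing from a closer to an opener. So every level
    contains an opener, giving nonzero rows, and by [lev_closer] every level that is left contains a
    closer, giving nonzero columns. *)
Lemma lev_opener s v : opener 0 -> v <= lev s ->
  exists z, [/\ z <= s, opener z & lev z = v].
Proof.
move=> o0; elim: s v => [|s IH] v /=.
  by rewrite leqn0 => /eqP->; exists 0.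
have [/IH[z [zs oz lz]] _|ltv lev] := leqP v (lev s); first by exists z; split=> //; lia.
by exists s.+1; split=> //=; [move: lev; case: opener => //=; lia|lia].
Qed.

Lemma lev_closer s v : v < lev s -> exists z, [/\ z < s, ~~ opener z & lev z = v].
Proof.
elim: s v => [|s IH] v //=.
have [/IH[z [zs oz lz]] _|ltv lev] := ltnP v (lev s); first by exists z; split=> //; lia.
by exists s; split=> //; [move: lev; case: opener => //=; lia|lia].
Qed.

End Levels.

(** * Injectivity: the cells can be read off the diagram *)

Section Recover.
Variables (n : nat) (c : seq (nat * nat)) (k : nat).
Hypotheses (sz : size c = n) (fc : fishburn k c).

Lemma opener_diagram (e : 'I_n * bool) : opener (diagram n c) (pos c e) = ~~ e.2.
Proof.
apply/existsP/idP=> [[x /existsP[y /andP[/eqP ex /(is_arc_diagram sz fc)[t [xt _]]]]]|].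
  by have /pos_inj<- : pos c (t, false) = pos c e by rewrite -xt; apply: val_inj.
case: e => t [] //= _; exists (pos c (t, false)); apply/existsP.
exists (pos c (t, true)); rewrite eqxx /=.
by apply/(is_arc_diagram sz fc); exists t.
Qed.

(** Induction along the positions. The level of the next endpoint cannot jump by two, since the
    skipped row would place an opener in between. *)
Lemma lev_diagram (e : 'I_n * bool) : lev (diagram n c) (pos c e) = level c e.
Proof.
have level_lt (e1 : 'I_n * bool) : level c e1 < k.
  by case: e1 => t []; rewrite /level /=; have := cell_le sz fc t; lia.
move E: (val (pos c e)) => s.
elim: s e E => [|s IH] e E.
  have [u ru] := row_onto sz fc (leq_ltn_trans (leq0n _) (level_lt e)).
  move: (pos_lt c (u, false) e); rewrite E ltn0 key_lt [level c (u, _)]/level ru /=.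
  by lia.
have lts : s < n.*2 by rewrite (leq_trans _ (ltn_ord (pos c e))) // E ltnW.
have [e' Ee'] := pos_surj c (Ordinal lts).
have es : val (pos c e') = s by rewrite -Ee'.
rewrite /= -{1}es -E opener_diagram -{1}es opener_diagram negbK.
rewrite es (IH e') //.
have adj (e'' : 'I_n * bool) : ~~ ((key c e' < key c e'') && (key c e'' < key c e)).
  by apply: pos_adjacent; rewrite E es.
have := pos_lt c e' e; rewrite E (es : (pos c e' : nat) = s) ltnSn => /esym.
rewrite key_lt => lt_e.
have [u2 cu2] := col_onto sz fc (level_lt e').
have [u1 ru1] := row_onto sz fc (level_lt e).
have [le_v|] := leqP (level c e) (level c e').+1; last first.
  move=> ltv; have [u ru] := row_onto sz fc (leq_trans ltv (ltnW (level_lt e))).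
  by move: (adj (u, false)); rewrite !key_lt /level /= in ltv ru *; lia.
(* If the level rises, e' must be a closer, or the closer u2 of its level would come between; and e
   must be an opener, or the opener u1 of its level would. *)
move: lt_e le_v (adj (u1, false)) (adj (u2, true)).
rewrite !key_lt /= ![level _ (_, _)]/level /=.
rewrite ru1 cu2; case: (e) (e') => [t b] [t' b'] /=.
by case: b b' => [] [] /=; lia.
Qed.

End Recover.

Lemma sorted_enum_ord m (A : {set 'I_m}) : sorted ltn [seq val x | x <- enum A].
Proof.
apply: (subseq_sorted ltn_trans _ (iota_ltn_sorted 0 m)).
by rewrite -val_enum_ord map_subseq // {1}/enum_mem -enumT filter_subseq.
Qed.

Lemma increasing_image m n (A : {set 'I_m}) : #|A| = n ->
  exists2 o : 'I_n -> 'I_m, (forall t t' : 'I_n, t < t' -> o t < o t') &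
    A = [set o t | t in 'I_n].
Proof.
move=> <-; exists enum_val => [t t' tt'|]; last first.
  apply/setP=> x; apply/idP/imsetP=> [xA|[t _ ->]]; last exact: enum_valP.
  by exists (enum_rank_in xA x); rewrite ?enum_rankK_in.
have x0 := enum_val t.
have lt_sz (u : 'I_#|A|) : u < size (enum A) by rewrite -cardE.
rewrite !(enum_val_nth x0) -!(nth_map _ 0 val) //.
by apply: (sorted_ltn_nth ltn_trans _ (sorted_enum_ord A)); rewrite ?inE ?size_map.
Qed.

Lemma increasing_eq m n (o o' : 'I_n -> 'I_m) :
  (forall t t' : 'I_n, t < t' -> o t < o t') ->
  (forall t t' : 'I_n, t < t' -> o' t < o' t') ->
  codom o =i codom o' -> o =1 o'.
Proof.
move=> inc inc' e t.
have so (f : 'I_n -> 'I_m) : (forall t t' : 'I_n, t < t' -> f t < f t') ->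
    sorted ltn [seq val x | x <- codom f].
  move=> incf; rewrite codomE -map_comp sorted_map.
  apply: (@sub_sorted _ (relpre val ltn)); first by move=> x y /incf.
  by rewrite -sorted_map val_enum_ord iota_ltn_sorted.
have : [seq val x | x <- codom o] = [seq val x | x <- codom o'].
  apply: (irr_sorted_eq ltn_trans ltnn (so o inc) (so o' inc')) => z.
  by apply/mapP/mapP=> -[x xo ->]; exists x; rewrite ?e // -e.
move/(inj_map val_inj); rewrite !codomE => /eq_in_map; apply.
by rewrite mem_enum.
Qed.

Lemma card_ord_lt m (x : 'I_m) : #|[set y : 'I_m | y < x]| = x.
Proof.
have -> : [set y : 'I_m | y < x] = widen_ord (ltnW (ltn_ord x)) @: setT.
  apply/setP=> y; rewrite inE; apply/idP/imsetP=> [yx|[z _ ->]] /=; last exact: ltn_ord.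
  by exists (Ordinal yx) => //; apply: val_inj.
by rewrite card_imset ?cardsT ?card_ord // => y z /(congr1 val) /= /val_inj.
Qed.

Section Inj.
Variables (n : nat).

(** The set of openers determines the t-th opener, the arcs determine its closer, and [lev] of the
    two gives back the t-th cell. *)
Lemma diagram_inj k k' c c' : size c = n -> size c' = n ->
  fishburn k c -> fishburn k' c' -> diagram n c = diagram n c' -> c = c'.
Proof.
move=> sz sz' fc fc' eqM.
have imo l d (szd : size d = n) (fd : fishburn l d) (x : 'I_n.*2) :
    (x \in codom (fun t : 'I_n => pos d (t, false))) = opener (diagram n d) x.
  apply/codomP/idP=> [[t ->]|]; first by rewrite (opener_diagram szd fd).
  have [[t b] ->] := pos_surj d x; rewrite (opener_diagram szd fd).
  by case: b => //; exists t.
have eqo : (fun t : 'I_n => pos c (t, false)) =1 (fun t => pos c' (t, false)).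
  apply: increasing_eq => [t t' tt'|t t' tt'|x].
  - by rewrite pos_lt (key_lt_oo sz fc).
  - by rewrite pos_lt (key_lt_oo sz' fc').
  - by rewrite (imo k c) // (imo k' c') // eqM.
have eqc (t : 'I_n) : pos c (t, true) = pos c' (t, true).
  have : is_arc (diagram n c) (pos c (t, false)) (pos c (t, true)).
    by apply/(is_arc_diagram sz fc); exists t.
  rewrite eqM => /(is_arc_diagram sz' fc')[u []].
  by rewrite eqo => /pos_inj[<-].
apply: (@eq_from_nth _ (0, 0)); first by rewrite sz sz'.
rewrite sz => i lti; pose t := Ordinal lti.
have := lev_diagram sz fc (t, false); have := lev_diagram sz fc (t, true).
rewrite eqo eqc eqM !(lev_diagram sz' fc') /level /= /row_of /col_of.
by case: (nth _ c i) (nth _ c' i) => [a b] [a' b'] /= -> ->.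
Qed.

End Inj.

(** * Surjectivity: reading a matrix off a Stoimenow matching *)

Lemma card_matching n (M : {set {set 'I_n.*2}}) : is_matching M -> #|M| = n.
Proof.
case/andP=> pM /forall_inP cM.
have := card_uniform_partition (n := 2) (fun A AM => eqP (cM A AM)) pM.
by rewrite cardsT card_ord; lia.
Qed.

(** A block is determined by its smaller element, so there are n openers; the arcs are numbered by
    increasing opener. *)
Lemma matching_arcs n (M : {set {set 'I_n.*2}}) : is_matching M ->
  exists o cl : 'I_n -> 'I_n.*2,
  [/\ forall t, o t < cl t, forall t t' : 'I_n, t < t' -> o t < o t' &
      M = [set [set o t; cl t] | t in 'I_n]].
Proof.
move=> mM; have [/and3P[/eqP cov triv _] /forall_inP cM] := andP mM.
pose O := [set x | [exists y, is_arc M x y]].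
have blockP x y : is_arc M x y -> pblock M x = [set x; y].
  by case/andP=> _ xyM; rewrite (def_pblock triv xyM) // !inE eqxx.
have blockO B : B \in M -> exists2 x, x \in O & B = pblock M x.
  move=> BM; have /cards2P[x [y [neq BE]]] := cM B BM.
  have [lt_xy|lt_yx] : x < y \/ y < x by move: neq; rewrite -val_eqE /=; lia.
    have xy : is_arc M x y by rewrite /is_arc lt_xy -BE.
    by exists x; rewrite ?(blockP _ _ xy) // inE; apply/existsP; exists y.
  have yx : is_arc M y x by rewrite /is_arc lt_yx setUC -BE.
  by exists y; rewrite ?(blockP _ _ yx) 1?setUC // inE; apply/existsP; exists x.
have cO : #|O| = n.
  apply: etrans (card_matching mM); apply/esym.
  have -> : M = [set pblock M x | x in O].
    apply/setP=> B; apply/idP/imsetP=> [/blockO[x ? ?]|[x]]; first by exists x.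
    by rewrite inE => /existsP[y xy] ->; rewrite (blockP _ _ xy); case/andP: xy.
  rewrite card_in_imset // => x x'; rewrite !inE.
  case/existsP=> y xy /existsP[y' xy'].
  rewrite (blockP _ _ xy) (blockP _ _ xy') => /setP E.
  have := E x; have := E x'; rewrite !inE !eqxx /=.
  case/andP: xy => lt_xy _; case/andP: xy' => lt_xy' _.
  case/predU1P=> [->//|/eqP ex'] /esym/predU1P[//|/eqP ex].
  by move: lt_xy lt_xy'; rewrite -ex -ex' => /ltn_trans H /H; rewrite ltnn.
have [o inc_o OE] := increasing_image cO.
have /fin_all_exists[cl arcs] : forall t, exists y, is_arc M (o t) y.
  move=> t; apply/existsP.
  have : o t \in O by rewrite OE imset_f.
  by rewrite inE.
exists o, cl; split=> // [t|]; first by case/andP: (arcs t).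
apply/setP=> B; apply/idP/imsetP=> [/blockO[x]|[t _ ->]]; last by case/andP: (arcs t).
by rewrite OE => /imsetP[t _ ->] ->; exists t; rewrite ?(blockP _ _ (arcs t)).
Qed.

Lemma surj_inj_ord (T : finType) m (f : T -> 'I_m) : #|T| = m ->
  (forall x, exists e, x = f e) -> injective f.
Proof.
move=> cT surj; suff /image_injP : #|image f T| == #|T| by move=> inj x y; apply: inj.
have -> : #|image f T| = #|'I_m|; last by rewrite card_ord cT.
by apply: eq_card => x; have [e ->] := surj x; rewrite image_f.
Qed.

Section Surj.
Variables (n : nat) (M : {set {set 'I_n.*2}}).
Hypothesis sM : stoimenow M.
Variables o cl : 'I_n -> 'I_n.*2.
Hypothesis ocl : forall t, o t < cl t.
Hypothesis inc_o : forall t t' : 'I_n, t < t' -> o t < o t'.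
Hypothesis ME : M = [set [set o t; cl t] | t in 'I_n].

Definition endpoint (e : 'I_n * bool) := if e.2 then cl e.1 else o e.1.

Lemma endpoint_surj x : exists e, x = endpoint e.
Proof.
have /and3P[/andP[/and3P[/eqP cov _ _] _] _ _] := sM.
have : x \in cover M by rewrite cov inE.
case/bigcupP=> B; rewrite ME => /imsetP[t _ ->]; rewrite !inE.
by case/orP=> /eqP xE; [exists (t, false) | exists (t, true)]; rewrite xE.
Qed.

Lemma endpoint_inj : injective endpoint.
Proof.
by apply: (surj_inj_ord _ endpoint_surj); rewrite card_prod !card_ord card_bool muln2.
Qed.

Lemma arc_endpoint t : is_arc M (o t) (cl t).
Proof. by rewrite /is_arc ocl ME; apply: (imset_f (fun t => [set o t; cl t])). Qed.

Lemma opener_endpoint e : opener M (endpoint e) = ~~ e.2.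
Proof.
apply/existsP/idP=> [[x /existsP[y /andP[/eqP/val_inj-> ]]]|]; last first.
  case: e => t [] // _; exists (o t); apply/existsP; exists (cl t).
  by rewrite eqxx arc_endpoint.
case: e => t [] //=; rewrite /endpoint /= => /andP[lty].
rewrite ME => /imsetP[u _ /setP E].
have := E (cl t); have := E y; rewrite !inE !eqxx orbT /= => /esym E1 /esym.
case/orP=> /eqP ect.
  by have := @endpoint_inj (t, true) (u, false); rewrite /endpoint /= => /(_ ect).
case/orP: E1 => /eqP ey; move: lty; rewrite ect ey ?ltnn //.
by move/(ltn_trans (ocl u)); rewrite ltnn.
Qed.

(** For adjacent closers this is the absence of Type 2. Induction on the distance extends it, as
    [closer_run] makes every position in between a closer of the same level. *)
Lemma closers_increasing t t' :
  cl t < cl t' -> lev M (cl t) = lev M (cl t') -> t < t'.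
Proof.
have adj u u' : val (cl u') = (cl u).+1 -> u < u'.
  move=> E; rewrite ltnNge leq_eqVlt; apply/norP; split.
    by apply/eqP=> /val_inj uu'; move: E; rewrite uu' /=; lia.
  apply/negP=> /inc_o ltu; have /and3P[_ _ /negP[]] := sM.
  apply/existsP; exists (o u'); apply/existsP; exists (o u).
  apply/existsP; exists (cl u); apply/existsP; exists (cl u').
  by rewrite !arc_endpoint ltu ocl; apply/and4P; split=> //; apply/eqP.
move=> lt_tt'; have [d E] : exists d, val (cl t') = cl t + d.+1.
  by exists (cl t' - cl t).-1; rewrite /=; lia.
elim: d t' E {lt_tt'} => [|d IH] t' E le; first by apply: adj; rewrite E addn1.
have ltz : (cl t + d.+1) < n.*2 by have := ltn_ord (cl t'); rewrite /= in E; lia.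
have [[w b] Ew] := endpoint_surj (Ordinal ltz).
have zE : val (endpoint (w, b)) = cl t + d.+1 by rewrite -Ew.
have tz : cl t <= endpoint (w, b) by rewrite (zE : nat_of_ord _ = _); lia.
have zt' : endpoint (w, b) <= cl t'
  by rewrite (zE : nat_of_ord _ = _) (E : nat_of_ord _ = _); lia.
have lez : lev M (cl t) = lev M (endpoint (w, b)).
  by have := lev_mono M tz; have := lev_mono M zt'; lia.
have := closer_run (leq_trans tz zt') le _ (z := endpoint (w, b)).
have -> : opener M (cl t) = false by have := opener_endpoint (t, true).
rewrite tz zt' opener_endpoint negbK => /(_ isT isT) /= bT.
rewrite bT in zE lez; apply: (ltn_trans (IH w zE lez)).
by apply: adj; rewrite E (zE : nat_of_ord (cl w) = _); lia.
Qed.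

(** The counterpart for runs of openers, from the absence of Type 1. *)
Lemma openers_increasing t t' :
  o t < o t' -> lev M (o t) = lev M (o t') -> cl t < cl t'.
Proof.
have adj u u' : val (o u') = (o u).+1 -> cl u < cl u'.
  move=> E; have /and3P[_ N _] := sM.
  rewrite ltnNge leq_eqVlt; apply/norP; split.
    apply/eqP=> /val_inj uu'.
    have /endpoint_inj[uu] : endpoint (u', true) = endpoint (u, true) by [].
    by move: E; rewrite uu /=; lia.
  apply/negP=> ltu; case/negP: N.
  apply/existsP; exists (o u); apply/existsP; exists (o u').
  apply/existsP; exists (cl u'); apply/existsP; exists (cl u).
  by rewrite !arc_endpoint ltu ocl; apply/and4P; split=> //; apply/eqP.
move=> lt_tt'; have [d E] : exists d, val (o t') = o t + d.+1.
  by exists (o t' - o t).-1; rewrite /=; lia.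
elim: d t' E {lt_tt'} => [|d IH] t' E le; first by apply: adj; rewrite E addn1.
have ltz : (o t + d.+1) < n.*2 by have := ltn_ord (o t'); rewrite /= in E; lia.
have [[w b] Ew] := endpoint_surj (Ordinal ltz).
have zE : val (endpoint (w, b)) = o t + d.+1 by rewrite -Ew.
have tz : o t <= endpoint (w, b) by rewrite (zE : nat_of_ord _ = _); lia.
have zt' : endpoint (w, b) <= o t'
  by rewrite (zE : nat_of_ord _ = _) (E : nat_of_ord _ = _); lia.
have lez : lev M (o t) = lev M (endpoint (w, b)).
  by have := lev_mono M tz; have := lev_mono M zt'; lia.
have := opener_run (leq_trans tz zt') le _ (z := endpoint (w, b)).
have -> : opener M (o t') by have := opener_endpoint (t', false).
rewrite tz zt' opener_endpoint => /(_ isT isT) /= /negbTE bF.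
rewrite bF in zE lez; apply: (ltn_trans (IH w zE lez)).
by apply: adj; rewrite E (zE : nat_of_ord (o w) = _); lia.
Qed.

Definition cells_of := [seq (lev M (o t), lev M (cl t)) | t <- enum 'I_n].

Lemma size_cells_of : size cells_of = n.
Proof. by rewrite size_map size_enum_ord. Qed.

Lemma level_cells_of e : level cells_of e = lev M (endpoint e).
Proof.
have E (t : 'I_n) : nth (0, 0) cells_of t = (lev M (o t), lev M (cl t)).
  by rewrite (nth_map t) ?size_enum_ord // nth_ord_enum.
by case: e => t []; rewrite /level /row_of /col_of E.
Qed.

Lemma key_cells_of e e' : endpoint e < endpoint e' -> key cells_of e < key cells_of e'.
Proof.
move=> lt; rewrite key_lt !level_cells_of.
have := lev_mono M (ltnW lt); rewrite leq_eqVlt => /predU1P[E|->] //.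
rewrite E eqxx ltnn /=; case: e e' lt E => [t b] [t' b'].
case: b b' => [] []; rewrite /endpoint //=.
- exact: closers_increasing.
- move=> lt E; have := lev_lt lt _ _ (M := M).
  by rewrite (opener_endpoint (t, true)) (opener_endpoint (t', false)) E ltnn => /(_ isT isT).
- move=> lt _; rewrite ltnNge leq_eqVlt; apply/norP; split.
    by apply: contraTneq lt => /val_inj->; rewrite ltnn.
  by apply: contraTN lt => /inc_o; lia.
Qed.

Lemma key_cells_ofE e e' : (key cells_of e < key cells_of e') = (endpoint e < endpoint e').
Proof.
have [/key_cells_of->//|] := ltnP (endpoint e) (endpoint e').
rewrite leq_eqVlt => /predU1P[/val_inj/endpoint_inj->|/key_cells_of]; first by rewrite ltnn.
by move=> lt; apply/negbTE; lia.
Qed.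

(** A position is the number of endpoints to its left, and [key] orders the endpoints as they stand
    in M. *)
Lemma pos_cells_of e : pos cells_of e = endpoint e.
Proof.
apply: val_inj; rewrite /= /rank -[RHS]card_ord_lt -(card_imset _ endpoint_inj).
apply: eq_card => x; rewrite !inE; have [e' ->] := endpoint_surj x.
by rewrite (mem_imset _ _ endpoint_inj) inE key_cells_ofE.
Qed.

Lemma diagram_cells_of : diagram n cells_of = M.
Proof. by rewrite ME; apply: eq_imset => t; rewrite !pos_cells_of. Qed.

Lemma fishburn_cells_of : exists k, fishburn k cells_of.
Proof.
have memP t : (lev M (o t), lev M (cl t)) \in cells_of by rewrite map_f ?mem_enum.
have [n0|n_gt0] := posnP n.
  exists 0; have -> : cells_of = [::] by apply: size0nil; rewrite size_cells_of.
  by split.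
have ltL : n.*2.-1 < n.*2 by lia.
have lt0 : 0 < n.*2 by lia.
have [[tL bL] EL] := endpoint_surj (Ordinal ltL).
have [[t0 b0] E0] := endpoint_surj (Ordinal lt0).
have opL : ~~ opener M n.*2.-1.
  rewrite -[n.*2.-1]/(val (Ordinal ltL)) EL opener_endpoint negbK /=.
  case: bL EL => // /(congr1 val) /= EL.
  have := ocl tL; have := ltn_ord (cl tL); rewrite /endpoint /= in EL; lia.
have op0 : opener M 0.
  rewrite -[0]/(val (Ordinal lt0)) E0 opener_endpoint /=.
  case: b0 E0 => // /(congr1 val) /= E0.
  have := ocl t0; rewrite /endpoint /= in E0; lia.
(* Levels count from 0 and are largest at the last position, which is a closer; this settles the
   last column, not covered by [lev_closer]. *)
exists (lev M n.*2.-1).+1; split.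
- rewrite sorted_map; apply: (@sub_sorted _ (relpre val ltn)); last first.
    by rewrite -sorted_map val_enum_ord iota_ltn_sorted.
  move=> t t' /= /inc_o ltt; rewrite /lexle /=.
  have := lev_mono M (ltnW ltt); rewrite leq_eqVlt => /predU1P[E|->//].
  have := lev_mono M (ltnW (openers_increasing ltt E)).
  by rewrite E eqxx => ->; rewrite orbT.
- move=> _ /mapP[t _ ->] /=; apply/andP; split; first exact/lev_mono/ltnW.
  rewrite ltnS; apply: lev_mono; by have := ltn_ord (cl t); lia.
- move=> v; rewrite ltnS => /(lev_opener op0)[z [zL oz <-]].
  have ltz : z < n.*2 by lia.
  have [[t b] Et] := endpoint_surj (Ordinal ltz).
  move: oz; rewrite -[z]/(val (Ordinal ltz)) Et opener_endpoint; case: b Et => // Et _.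
  by exists (lev M (cl t)); apply: memP.
- move=> v; rewrite ltnS leq_eqVlt => lev_v.
  have [z [zL oz <-]] : exists z, [/\ z <= n.*2.-1, ~~ opener M z & lev M z = v].
    case/predU1P: lev_v => [->|/lev_closer[z [zs oz <-]]]; first by exists n.*2.-1.
    by exists z; split=> //; apply: ltnW.
  have ltz : z < n.*2 by lia.
  have [[t b] Et] := endpoint_surj (Ordinal ltz).
  move: oz; rewrite -[z]/(val (Ordinal ltz)) Et opener_endpoint; case: b Et => // Et _.
  by exists (lev M (o t)); apply: memP.
Qed.

End Surj.

Lemma diagram_surj n (M : {set {set 'I_n.*2}}) : stoimenow M ->
  exists k c, [/\ size c = n, fishburn k c & M = diagram n c].
Proof.
move=> sM; have /and3P[mM _ _] := sM.
have [o [cl [ocl inc_o ME]]] := matching_arcs mM.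
have [k fc] := fishburn_cells_of sM ocl inc_o ME.
exists k, (cells_of M o cl); split=> //; first exact: size_cells_of.
by rewrite (diagram_cells_of sM).
Qed.

(** * Pattern containment in terms of cells *)

Definition arcs4 (s : seq (nat * nat)) :=
  [&& all (fun p => [&& 0 < p.1, p.1 < p.2 & p.2 <= 8]) s, uniq s & size s == 4].

Lemma arc_label (p : nat * nat) : [&& 0 < p.1, p.1 < p.2 & p.2 <= 8] ->
  [set x : 'I_4.*2 | x.+1 \in [:: p.1; p.2]] = [set inord p.1.-1; inord p.2.-1].
Proof.
move=> wp; apply/setP=> x; rewrite !inE -!val_eqE /= ?inordK.
all: by rewrite ?/(4.*2) /=; lia.
Qed.

Lemma card_of_arcs s : arcs4 s -> #|of_arcs 4 s| = 4.
Proof.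
case/and3P=> /allP wf us /eqP sz; apply: etrans sz; rewrite cardsE.
rewrite -(size_map (fun p => [set x : 'I_4.*2 | x.+1 \in [:: p.1; p.2]]) s).
apply/card_uniqP; rewrite map_inj_in_uniq //.
move=> p q ps qs; rewrite !arc_label ?wf // => /setP E.
have := wf p ps; have := wf q qs; case: p q {ps qs} E => [a b] [a' b'] /= E wq wp.
have V i : i <= 7 -> nat_of_ord (inord i : 'I_8) = i by move=> ?; rewrite inordK.
have Ea := E (inord a.-1); have Eb := E (inord b.-1).
move: Ea Eb; rewrite !inE !eqxx !orbT -!val_eqE /= !V; try by lia.
by move=> Ea Eb; have [-> ->] : a = a' /\ b = b' by lia.
Qed.

(** Here [x i] is the endpoint with label i + 1, and only i < 8 matters. *)
Lemma contains_of_arcs n (M : {set {set 'I_n.*2}}) s : arcs4 s ->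
  contains M (of_arcs 4 s) <->
  exists x : nat -> 'I_n.*2, (forall i j, i < j < 8 -> x i < x j) /\
    {in s, forall p, [set x p.1.-1; x p.2.-1] \in M}.
Proof.
move=> wf; have /and3P[/allP wfp _ _] := wf; split.
  case/existsP=> A /and3P[/subsetP AM _ /existsP[f /andP[/forallP inc /eqP AE]]].
  exists (fun i => f (inord i)); split=> [i j ij|p ps].
    have /forallP/(_ (inord j))/implyP := inc (inord i); apply.
    by rewrite !inordK //; lia.
  apply: AM; rewrite AE; apply/imsetP.
  exists [set x : 'I_4.*2 | x.+1 \in [:: p.1; p.2]]; last first.
    by rewrite arc_label ?wfp // imsetU !imset_set1.
  by rewrite inE; apply: map_f.
case=> x [inc mem]; pose f := [ffun i : 'I_4.*2 => x i].
have incf (i j : 'I_4.*2) : i < j -> f i < f j.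
  by move=> ij; rewrite !ffunE inc // ij ltn_ord.
have injf : injective f.
  move=> i j e; apply: val_inj; have := incf i j; have := incf j i.
  by rewrite e ltnn /=; lia.
apply/existsP; exists [set f @: (B : {set 'I_4.*2}) | B in of_arcs 4 s].
apply/and3P; split.
- apply/subsetP=> _ /imsetP[B BP ->]; move: BP; rewrite inE => /mapP[p ps ->].
  rewrite arc_label ?wfp // imsetU !imset_set1 !ffunE.
  by have := wfp p ps => wp; rewrite !inordK ?mem //; lia.
- by rewrite card_imset ?card_of_arcs //; apply: imset_inj.
- apply/existsP; exists f; rewrite eqxx andbT.
  by apply/forallP=> i; apply/forallP=> j; apply/implyP/incf.
Qed.

(** A word lists the endpoints of a pattern from left to right, as pairs (arc, closer?); the labels
    are the places in the word. *)
Definition word_arcs (W : seq (nat * bool)) :=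
  [seq ((index (k, false) W).+1, (index (k, true) W).+1) | k <- iota 0 4].

Definition arc_word (W : seq (nat * bool)) :=
  [&& perm_eq W [seq (k, b) | k <- iota 0 4, b <- [:: false; true]],
      all (fun k => index (k, false) W < index (k, true) W) (iota 0 4) &
      arcs4 (word_arcs W)].

(** Seven comparisons between neighbouring endpoints suffice, and the [key_lt] lemmas express each
    through rows and columns. *)
Lemma contains_word n c k W : size c = n -> fishburn k c -> arc_word W ->
  contains (diagram n c) (of_arcs 4 (word_arcs W)) <->
  exists t : nat -> 'I_n, sorted ltn [seq key c (t z.1, z.2) | z <- W].
Proof.
move=> sz fc /and3P[pW /allP ltW wf].
have sW : size W = 8 by rewrite (perm_size pW).
have uW : uniq W by rewrite (perm_uniq pW).
have memW i b : i < 4 -> (i, b) \in W.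
  move=> lti; rewrite (perm_mem pW); apply/allpairsP; exists (i, b); split=> //.
    by rewrite mem_iota.
  by case: b.
rewrite contains_of_arcs //; split=> [[x [inc mem]]|[t st]].
  have tE (i : 'I_4) : exists t : 'I_n,
      x (index (nat_of_ord i, false) W) = pos c (t, false) /\
      x (index (nat_of_ord i, true) W) = pos c (t, true).
    have ii : val i \in iota 0 4 by rewrite mem_iota ltn_ord.
    apply: (mem_diagram sz fc).
      by apply: (mem ((index (val i, false) W).+1, (index (val i, true) W).+1)); apply: map_f.
    by apply: inc; rewrite (ltW _ ii) -sW index_mem memW.
  have [t {}tE] := fin_all_exists tE.
  exists (fun i => t (inord i)).
  have -> : [seq key c (t (inord z.1), z.2) | z <- W] =
      [seq key c (t (inord (nth (0, false) W i).1), (nth (0, false) W i).2)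
         | i <- iota 0 8].
    by rewrite -[W in LHS](mkseq_nth (0, false)) /mkseq -map_comp sW.
  rewrite sorted_map; apply/(sortedP 0) => i; rewrite size_iota => lti.
  have nthE j : j < 8 ->
      x j = pos c (t (inord (nth (0, false) W j).1), (nth (0, false) W j).2).
    move=> ltj; have jW : nth (0, false) W j \in W by rewrite mem_nth ?sW.
    have : j = index (nth (0, false) W j) W by rewrite index_uniq ?sW.
    move: jW; rewrite (perm_mem pW) => /allpairsP[[a b] [/= aI _ ->]] ->.
    have {}aI : a < 4 by move: aI; rewrite !inE; lia.
    have [E1 E2] := tE (inord a).
    by move: E1 E2; rewrite inordK //; case: b => /=.
  have lti' : i < 8 by lia.
  by rewrite !nth_iota //= !add0n -pos_lt -!nthE // inc // leqnn lti.
exists (fun i => let z := nth (0, false) W i in pos c (t z.1, z.2)); split.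
  move=> i j /andP[ij j8]; rewrite pos_lt.
  have := sorted_ltn_nth ltn_trans 0 st i j.
  rewrite !inE size_map sW => /(_ (ltn_trans ij j8) j8 ij).
  by rewrite !(nth_map (0, false)) ?sW // (ltn_trans ij).
move=> p /mapP[i]; rewrite mem_iota => lti -> /=.
by rewrite !nth_index ?memW //; apply/imsetP; exists (t i).
Qed.

(* The endpoints of each pattern from left to right, in the encoding of [level]. *)
Definition word2 := [:: (0, false); (1, false); (0, true); (2, false);
                        (1, true); (3, false); (2, true); (3, true)].
Definition word3 := [:: (0, false); (0, true); (1, false); (2, false);
                        (1, true); (2, true); (3, false); (3, true)].
Definition word4 := [:: (0, false); (0, true); (1, false); (2, false);
                        (1, true); (3, false); (2, true); (3, true)].
Definition word5 := [:: (0, false); (1, false); (0, true); (2, false);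
                        (1, true); (2, true); (3, false); (3, true)].

Section Patterns.
Variables (n : nat) (c : seq (nat * nat)) (k : nat).
Hypotheses (sz : size c = n) (fc : fishburn k c).

Definition closer_lt (t t' : 'I_n) :=
  (col_of c t < col_of c t') || (col_of c t == col_of c t') && (t < t').

Lemma exists4 (Q : 'I_n -> 'I_n -> 'I_n -> 'I_n -> Prop) :
  (exists t : nat -> 'I_n, Q (t 0) (t 1) (t 2) (t 3)) <->
  exists t0 t1 t2 t3, Q t0 t1 t2 t3.
Proof.
split=> [[t Qt]|[t0 [t1 [t2 [t3 Qt]]]]]; first by exists (t 0), (t 1), (t 2), (t 3).
by exists (fun i => nth t0 [:: t0; t1; t2; t3] i).
Qed.

Lemma contains_P2 : contains (diagram n c) P2 <-> exists t0 t1 t2 t3 : 'I_n,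
  [/\ t0 < t1, row_of c t1 <= col_of c t0 < row_of c t2,
      row_of c t2 <= col_of c t1 < row_of c t3, row_of c t3 <= col_of c t2 &
      closer_lt t2 t3].
Proof.
have -> : P2 = of_arcs 4 (word_arcs word2) by [].
rewrite (contains_word sz fc) // -exists4.
split=> -[t H]; exists t; move: H => /=.
all: rewrite !key_lt_oc !key_lt_co !(key_lt_oo sz fc) key_lt_cc; rewrite /closer_lt.
  by case/and5P=> -> -> -> -> /and4P[-> -> -> _].
by case=> -> /andP[-> ->] /andP[-> ->] -> ->.
Qed.

Lemma contains_P3 : contains (diagram n c) P3 <-> exists t0 t1 t2 t3 : 'I_n,
  [/\ col_of c t0 < row_of c t1, t1 < t2, row_of c t2 <= col_of c t1, closer_lt t1 t2 &
      col_of c t2 < row_of c t3].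
Proof.
have -> : P3 = of_arcs 4 (word_arcs word3) by [].
rewrite (contains_word sz fc) // -exists4.
split=> -[t H]; exists t; move: H => /=.
all: rewrite !key_lt_oc !key_lt_co !(key_lt_oo sz fc) key_lt_cc; rewrite /closer_lt.
  by case/and5P=> _ -> -> -> /and4P[-> -> _ _].
case=> -> -> -> -> ->; have := cell_le sz fc (t 0); have := cell_le sz fc (t 3).
by case/andP=> -> _ /andP[-> _].
Qed.

Lemma contains_P4 : contains (diagram n c) P4 <-> exists t0 t1 t2 t3 : 'I_n,
  [/\ col_of c t0 < row_of c t1, t1 < t2, row_of c t2 <= col_of c t1 < row_of c t3,
      row_of c t3 <= col_of c t2 & closer_lt t2 t3].
Proof.
have -> : P4 = of_arcs 4 (word_arcs word4) by [].
rewrite (contains_word sz fc) // -exists4.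
split=> -[t H]; exists t; move: H => /=.
all: rewrite !key_lt_oc !key_lt_co !(key_lt_oo sz fc) key_lt_cc; rewrite /closer_lt.
  by case/and5P=> _ -> -> -> /and4P[-> -> -> _].
case=> -> -> /andP[-> ->] -> ->; have := cell_le sz fc (t 0).
by case/andP=> -> _.
Qed.

Lemma contains_P5 : contains (diagram n c) P5 <-> exists t0 t1 t2 t3 : 'I_n,
  [/\ t0 < t1, row_of c t1 <= col_of c t0 < row_of c t2, row_of c t2 <= col_of c t1,
      closer_lt t1 t2 & col_of c t2 < row_of c t3].
Proof.
have -> : P5 = of_arcs 4 (word_arcs word5) by [].
rewrite (contains_word sz fc) // -exists4.
split=> -[t H]; exists t; move: H => /=.
all: rewrite !key_lt_oc !key_lt_co !(key_lt_oo sz fc) key_lt_cc; rewrite /closer_lt.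
  by case/and5P=> -> -> -> -> /and4P[-> -> _ _].
case=> -> /andP[-> ->] -> -> ->; have := cell_le sz fc (t 3).
by case/andP=> -> _.
Qed.

Lemma index_lt (t t' : 'I_n) : (row_of c t < row_of c t') ||
  (row_of c t == row_of c t') && (col_of c t < col_of c t') -> t < t'.
Proof.
case/orP=> [/(row_lt sz fc) //|/andP[/eqP er lt]].
by rewrite ltnNge; apply: contraL lt => /(col_mono sz fc (esym er)); lia.
Qed.

(** Upper triangularity leaves column 0 only this entry. It plays the arc [1,2] of P3 and P4;
    [last_cell] plays [7,8] of P3 and P5. *)
Lemma first_cell : 0 < k -> exists t : 'I_n, row_of c t = 0 /\ col_of c t = 0.
Proof.
by case/(col_onto sz fc)=> t t0; exists t; have := cell_le sz fc t; lia.
Qed.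

Lemma last_cell : 0 < k -> exists t : 'I_n, row_of c t = k.-1 /\ col_of c t = k.-1.
Proof.
move=> k0; have [|t tk] := row_onto sz fc (v := k.-1); first by lia.
by exists t; have := cell_le sz fc t; lia.
Qed.

(** The two cells are the middle arcs [3,5] and [4,7]. If j < j', any arc opening in row j' serves
    as [6,8], and i > 0 leaves room for [1,2]. *)
Lemma avoid_P4 : ~~ contains (diagram n c) P4 <->
  forall i j i' j', (i, j) \in c -> (i', j') \in c -> 0 < i <= i' -> i' <= j -> j' <= j.
Proof.
split=> [/negP av i j i' j' ijc ij'c ii' i'j|H]; last first.
  apply/negP=> /contains_P4[t0 [t1 [t2 [t3 [c01 lt12 /andP[c21 c13] c32]]]]].
  have := H _ _ _ _ (cell_mem sz t1) (cell_mem sz t2).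
  have := row_mono sz fc (ltnW lt12); rewrite /closer_lt; lia.
have [t1 [r1 c1]] := cell_index sz ijc; have [t2 [r2 c2]] := cell_index sz ij'c.
move: r1 c1 r2 c2 => /= r1 c1 r2 c2.
have le2 := cell_le sz fc t2; have le1 := cell_le sz fc t1.
have [|t0 [r0 c0]] := first_cell; first by lia.
have [|t3 r3] := row_onto sz fc (v := j'); first by lia.
rewrite leqNgt; apply/negP=> ltj; apply/av/contains_P4; exists t0, t1, t2, t3.
have le3 := cell_le sz fc t3.
have lt12 : t1 < t2 by apply: index_lt; lia.
have lt23 : t2 < t3 by apply: index_lt; lia.
by split; rewrite /closer_lt; lia.
Qed.

(** Mirror image of [avoid_P4]: any arc closing in column i serves as [1,3]. *)
Lemma avoid_P5 : ~~ contains (diagram n c) P5 <->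
  forall i j i' j', (i, j) \in c -> (i', j') \in c -> i' <= j <= j' -> j' < k.-1 -> i' <= i.
Proof.
split=> [/negP av i j i' j' ijc ij'c ii' i'j|H]; last first.
  apply/negP=> /contains_P5[t0 [t1 [t2 [t3 [c01 /andP[c10 c02] c21 c12 c23]]]]].
  have := H _ _ _ _ (cell_mem sz t1) (cell_mem sz t2).
  have := cell_le sz fc t3; move: c12; rewrite /closer_lt; lia.
have [t1 [r1 c1]] := cell_index sz ijc; have [t2 [r2 c2]] := cell_index sz ij'c.
move: r1 c1 r2 c2 => /= r1 c1 r2 c2.
have le2 := cell_le sz fc t2; have le1 := cell_le sz fc t1.
have [|t3 [r3 c3]] := last_cell; first by lia.
have [|t0 c0] := col_onto sz fc (v := i); first by lia.
rewrite leqNgt; apply/negP=> lti; apply/av/contains_P5; exists t0, t1, t2, t3.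
have le0 := cell_le sz fc t0.
have lt01 : t0 < t1 by apply: index_lt; lia.
have lt12 : t1 < t2 by apply: index_lt; lia.
by split; rewrite /closer_lt; lia.
Qed.

(** Stated for arcs rather than cells, because the crossing middle arcs may be two copies of one
    cell. *)
Lemma avoid_P3 : ~~ contains (diagram n c) P3 <->
  forall t t' : 'I_n, t < t' -> 0 < row_of c t -> row_of c t' <= col_of c t <= col_of c t' ->
  k.-1 <= col_of c t'.
Proof.
split=> [/negP av t1 t2 lt12 r1 c12|H]; last first.
  apply/negP=> /contains_P3[t0 [t1 [t2 [t3 [c01 lt12 c21 c12 c23]]]]].
  have := H _ _ lt12; have := cell_le sz fc t3; move: c12; rewrite /closer_lt; lia.
have le2 := cell_le sz fc t2.
have [|t0 [r0 c0]] := first_cell; first by lia.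
have [|t3 [r3 c3]] := last_cell; first by lia.
rewrite leqNgt; apply/negP=> ltk; apply/av/contains_P3; exists t0, t1, t2, t3.
by split; rewrite /closer_lt; lia.
Qed.

End Patterns.

(** * The structure of the avoiders *)

Definition structured (T : nat -> nat -> nat -> bool) k (c : seq (nat * nat)) :=
  (forall i j, (i, j) \in c -> [|| i == 0, j == i | j == k.-1]) /\
  forall i, 0 < i < k.-1 ->
    T (count_mem (i, i) c) (count_mem (i, k.-1) c) (count_mem (0, i) c).

Definition triple_P2P4 (d e f : nat) := (0 < d) && (e == 0).
Definition triple_P3P4 (d e f : nat) := (d == 1) && (e == 0) || [&& d == 0, 0 < e & 0 < f].
Definition triple_P4P5 (d e f : nat) :=
  [&& 0 < d, e == 0 & f == 0] || [&& d == 0, 0 < e & 0 < f].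

Section Structure.
Variables (n : nat) (c : seq (nat * nat)) (k : nat).
Hypotheses (sz : size c = n) (fc : fishburn k c).

Lemma count_gt0 x : (0 < count_mem x c) = (x \in c).
Proof. by rewrite -has_count has_pred1. Qed.

Lemma count_gt1P x : reflect
  (exists t t' : 'I_n,
     [/\ t < t', (row_of c t, col_of c t) = x & (row_of c t', col_of c t') = x])
  (1 < count_mem x c).
Proof.
have -> : count_mem x c = #|[set t : 'I_n | nth (0, 0) c t == x]|.
  by rewrite -sum1_count (big_nth (0, 0)) sz big_mkord sum1dep_card.
rewrite /row_of /col_of; apply: (iffP card_gt1P) => [[t [t' []]]|[t [t' [lt E E']]]].
  rewrite !inE => /eqP E /eqP E' neq.
  have [lt|lt] : t < t' \/ t' < t by move: neq; rewrite -val_eqE /=; lia.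
    by exists t, t'; rewrite -!surjective_pairing.
  by exists t', t; rewrite -!surjective_pairing.
exists t, t'; rewrite !inE -!surjective_pairing in E E' *.
by rewrite E E' -val_eqE /= neq_ltn lt.
Qed.

Lemma nested_rows : (forall i j i' j', (i, j) \in c -> (i', j') \in c ->
    0 < i <= i' -> i' <= j -> j' <= j) ->
  forall i, 0 < i < k -> (i, i) \in c -> forall j, (i, j) \in c -> j = i.
Proof.
move=> av i i0 ii j ij; have := av _ _ _ _ ii ij; have := fishburn_upper fc ij => /=; lia.
Qed.

(** The converse for P4 shared by the three cases: a violation could only be a row with both its
    diagonal and its last entry nonzero, which T excludes. *)
Lemma structured_nested T :
  structured T k c -> (forall d e f, T d e f -> (d == 0) || (e == 0)) ->
  forall i j i' j', (i, j) \in c -> (i', j') \in c -> 0 < i <= i' -> i' <= j -> j' <= j.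
Proof.
move=> [str1 str2] Tde i j i' j' ij ij' ii' i'j.
have := str1 _ _ ij; have := str1 _ _ ij'.
have /= := fishburn_upper fc ij; have /= := fishburn_upper fc ij' => u' u s' s.
have j'k : j' <= k.-1 by lia.
have [->//|neq] := eqVneq j k.-1.
have {s}ji : j = i by lia.
have ei : i' = i by lia.
subst j i'; have [->//|nj] := eqVneq j' i.
have ej : j' = k.-1 by lia.
have /str2/Tde : 0 < i < k.-1 by lia.
by rewrite !eqn0Ngt !count_gt0 ij -ej ij'.
Qed.

Lemma structured_row T : structured T k c -> forall i, 0 < i < k.-1 ->
  ((i, i) \in c) || ((i, k.-1) \in c).
Proof.
move=> [str1 _] i ik; have [|j ij] := fishburn_row fc (v := i); first by lia.
have := str1 _ _ ij; case/or3P=> [|/eqP|/eqP] E; first by lia.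
  by rewrite -{2}E ij.
by rewrite -E ij orbT.
Qed.

Lemma structured_col T : structured T k c -> forall i, 0 < i < k.-1 ->
  ((i, i) \in c) || ((0, i) \in c).
Proof.
move=> [str1 _] i ik; have [|j ij] := fishburn_col fc (v := i); first by lia.
have := str1 _ _ ij; case/or3P=> [/eqP|/eqP|/eqP] E; last by lia.
  by rewrite -E ij orbT.
by rewrite {1}E ij.
Qed.

(** Let (i, j) be a cell with 0 < i < j and (x, i) a cell of column i. If x > 0, the two violate the
    condition for P4; if x = 0, then (0, 0), (0, i), (i, j) and any arc of row j form P2. *)
Lemma avoid_P2P4 : ~~ contains (diagram n c) P2 /\ ~~ contains (diagram n c) P4 <->
  structured triple_P2P4 k c.
Proof.
split=> [[/negP av2 /(avoid_P4 sz fc) av4]|str].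
  have diag i j : (i, j) \in c -> 0 < i -> j = i.
    move=> ij i0; have /= := fishburn_upper fc ij => le_ij.
    apply/eqP; rewrite eqn_leq andbC; case/andP: (le_ij) => -> _ /=.
    rewrite leqNgt; apply/negP=> lt_ij.
    have [|x xi] := fishburn_col fc (v := i); first by lia.
    have /= := fishburn_upper fc xi => le_xi.
    have [x0|x0] := posnP x; last by have := av4 _ _ _ _ xi ij; lia.
    have [|t0 [r0 c0]] := first_cell sz fc; first by lia.
    have [t1 /= [r1 c1]] := cell_index sz xi.
    have [t2 /= [r2 c2]] := cell_index sz ij.
    have [|t3 r3] := row_onto sz fc (v := j); first by lia.
    have le3 := cell_le sz fc t3.
    have lt01 : t0 < t1 by apply: (index_lt sz fc); lia.
    have lt23 : t2 < t3 by apply: (index_lt sz fc); lia.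
    by apply/av2/(contains_P2 sz fc); exists t0, t1, t2, t3; split; rewrite /closer_lt; lia.
  split=> [i j ij|i ik].
    by have [->//|/(diag _ _ ij)->] := posnP i; rewrite eqxx orbT.
  apply/andP; split.
    rewrite count_gt0; have [|j ij] := fishburn_row fc (v := i); first by lia.
    by rewrite -{2}(diag _ _ ij) //; lia.
  by rewrite eqn0Ngt count_gt0; apply/negP=> /diag; lia.
have av4 : ~~ contains (diagram n c) P4.
  by apply/(avoid_P4 sz fc)/(structured_nested str) => d e f /andP[_ ->]; rewrite orbT.
split; last exact: av4.
apply/negP=> /(contains_P2 sz fc)[t0 [t1 [t2 [t3 [lt01 c02 c23 c32 c23']]]]].
(* The third arc of P2 lies below row 0 and off the diagonal, hence in the last column, where e =
   0. *)
have {lt01 c02 c23 c32 c23'} [lt0 lt2] : 0 < row_of c t2 /\ row_of c t2 < col_of c t2 by lia.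
have le2 := cell_le sz fc t2.
have E2 : col_of c t2 = k.-1.
  by have := str.1 _ _ (cell_mem sz t2); case/or3P=> [|/eqP|/eqP//]; lia.
have /str.2/andP[_] : 0 < row_of c t2 < k.-1 by lia.
by rewrite eqn0Ngt count_gt0 -E2 cell_mem.
Qed.

(** For a cell (i, j) with 0 < i < j < K, the P4 condition puts row j on the diagonal, and (i, j),
    (j, j) then give P3. Conversely, middle arcs of P3 must be two copies of one diagonal cell,
    contrary to d <= 1. *)
Lemma avoid_P3P4 : ~~ contains (diagram n c) P3 /\ ~~ contains (diagram n c) P4 <->
  structured triple_P3P4 k c.
Proof.
split=> [[/(avoid_P3 sz fc) av3 /(avoid_P4 sz fc) av4]|str].
  have str1 i j : (i, j) \in c -> [|| i == 0, j == i | j == k.-1].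
    move=> ij; have /= := fishburn_upper fc ij => le_ij.
    have [//|i0] := posnP i; apply/norP=> -[ji jk].
    have [|j' jj'] := fishburn_row fc (v := j); first by lia.
    have le_jj' := fishburn_upper fc jj'.
    have := av4 _ _ _ _ ij jj'; rewrite /= in le_jj' * => ej.
    have [t1 /= [r1 c1]] := cell_index sz ij.
    have [t2 /= [r2 c2]] := cell_index sz jj'.
    have lt12 : t1 < t2 by apply: (index_lt sz fc); lia.
    by have := av3 _ _ lt12; lia.
  have str : structured (fun _ _ _ => true) k c by [].
  split=> // i ik; have := structured_row str ik; have := structured_col str ik.
  have := @nested_rows av4 i _ _ k.-1.
  have : count_mem (i, i) c <= 1.
    rewrite leqNgt; apply/negP=> /count_gt1P[t [t' [lt [r1 c1] [r2 c2]]]].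
    by have := av3 _ _ lt; lia.
  rewrite /triple_P3P4 -!count_gt0.
  move: (count_mem (i, i) c) (count_mem (i, k.-1) c) (count_mem (0, i) c) => d e f.
  by lia.
have av4 : ~~ contains (diagram n c) P4.
  by apply/(avoid_P4 sz fc)/(structured_nested str) => d e f; rewrite /triple_P3P4; lia.
split; last exact: av4.
apply/(avoid_P3 sz fc) => t t' lt r0 H.
have := str.1 _ _ (cell_mem sz t); have := str.1 _ _ (cell_mem sz t').
have le := cell_le sz fc t; have le' := cell_le sz fc t'.
have := row_mono sz fc (ltnW lt) => rm s' s.
rewrite leqNgt; apply/negP=> ltk.
have : 1 < count_mem (row_of c t, row_of c t) c.
  apply/count_gt1P; exists t, t'; split=> //; congr pair; lia.
have /str.2 : 0 < row_of c t < k.-1 by lia.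
by rewrite /triple_P3P4; lia.
Qed.

(** As for P3 and P4, the cells (i, j), (j, j) now giving P5. *)
Lemma avoid_P4P5 : ~~ contains (diagram n c) P4 /\ ~~ contains (diagram n c) P5 <->
  structured triple_P4P5 k c.
Proof.
split=> [[/(avoid_P4 sz fc) av4 /(avoid_P5 sz fc) av5]|str].
  have str1 i j : (i, j) \in c -> [|| i == 0, j == i | j == k.-1].
    move=> ij; have /= := fishburn_upper fc ij => le_ij.
    have [//|i0] := posnP i; apply/norP=> -[ji jk].
    have [|j' jj'] := fishburn_row fc (v := j); first by lia.
    have /= := fishburn_upper fc jj'.
    by have := av4 _ _ _ _ ij jj'; have := av5 _ _ _ _ ij jj'; lia.
  have str : structured (fun _ _ _ => true) k c by [].
  split=> // i ik; have := structured_row str ik; have := structured_col str ik.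
  (* Cells (0, i) and (i, i) together would give P5, so d > 0 forces f = 0. *)
  have := @nested_rows av4 i _ _ k.-1; have := av5 0 i i i.
  rewrite /triple_P4P5 -!count_gt0.
  move: (count_mem (i, i) c) (count_mem (i, k.-1) c) (count_mem (0, i) c) => d e f.
  by lia.
have av4 : ~~ contains (diagram n c) P4.
  by apply/(avoid_P4 sz fc)/(structured_nested str) => d e f; rewrite /triple_P4P5; lia.
split; first exact: av4.
apply/(avoid_P5 sz fc) => i j i' j' ij ij' ii' j'k.
have := str.1 _ _ ij; have := str.1 _ _ ij'; rewrite leqNgt => s' s; apply/negP=> lt.
have ei : i = 0 by lia.
have ej : j = i' /\ j' = i' by lia.
move: ij ij'; rewrite ei ej.1 ej.2 -!count_gt0.
have /str.2 : 0 < i' < k.-1 by lia.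
rewrite /triple_P4P5.
move: (count_mem (i', i') c) (count_mem (i', k.-1) c) (count_mem (0, i') c) => d e f.
by lia.
Qed.

End Structure.

(** * Counting *)

Definition weight (q : seq (nat * nat)) := sumn [seq x.1 + x.2 | x <- q].

(** The default (0, 0) makes the empty sequence a code, the one of weight 0. *)
Definition is_code (q : seq (nat * nat)) :=
  all (fun x => 0 < x.1) q && ((nth (0, 0) q 0).2 == 0).

(* Codes are grown at their last pair, so they are listed in reverse order; the     *)
(* bottom of the list is the first pair (m, 0), which may not gain weight in its    *)
(* second component.                                                                *)
Definition grow (w : seq (nat * nat)) :=
  if w is (m, r) :: w' then
    ((1, 0) :: w) :: (if r == 0 then [:: (m.+1, 0) :: w'] else [::]) ++
    (if w' is _ :: _ then [:: (m, r.+1) :: w'] else [::])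
  else [:: [:: (1, 0)]].

(** In [grow], m increases only while r = 0, so the last unit added is determined: from r if r > 0,
    else from m, else the whole pair (1, 0). *)
Definition parent (w : seq (nat * nat)) :=
  if w is (m, r) :: w' then
    if 0 < r then (m, r.-1) :: w' else if 1 < m then (m.-1, 0) :: w' else w'
  else [::].

Fixpoint rev_codes n :=
  if n is n'.+1 then flatten [seq grow w | w <- rev_codes n'] else [:: [::]].

Lemma nth0_rev (w : seq (nat * nat)) : nth (0, 0) (rev w) 0 = last (0, 0) w.
Proof. by case/lastP: w => [|w x]; rewrite ?rev_rcons ?last_rcons. Qed.

Lemma weight_rev w : weight (rev w) = weight w.
Proof. by rewrite /weight map_rev sumn_rev. Qed.

Lemma is_code_rev w :
  is_code (rev w) = all (fun x => 0 < x.1) w && ((last (0, 0) w).2 == 0).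
Proof. by rewrite /is_code all_rev nth0_rev. Qed.

(** Since children are recognised by [parent], different codes have disjoint families and every
    nonempty code lies in one. *)
Lemma mem_grow w x : is_code (rev w) ->
  (x \in grow w) = [&& is_code (rev x), weight x == (weight w).+1 & parent x == w].
Proof.
rewrite !is_code_rev /weight; case: w => [_|[m r] w] /=.
  rewrite inE; apply/eqP/idP=> [->//|/and3P[]].
  case: x => [|[m r] x] //= /andP[/andP[m0 am] lst] wt.
  case: ifP => // r0; case: ifP => // m1 /eqP xE; subst x.
  by rewrite /= in wt; congr [:: (_, _)]; lia.
rewrite inE mem_cat; case/andP=> /andP[m0 aw] lst; apply/idP/idP.
- case/orP=> [/eqP->|/orP[]] /=.
  + by rewrite m0 aw lst eqxx !andbT /=; lia.
  + have [r0|//] := eqVneq r 0; rewrite inE => /eqP->; rewrite /= aw r0.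
    apply/andP; split; first by case: (w) lst.
    by rewrite ?ltnS m0 eqxx andbT; lia.
  + case: w aw lst => // y w aw lst; rewrite inE => /eqP->; rewrite /= in aw lst *.
    by rewrite m0 aw lst eqxx !andbT; lia.
- case/and3P; case: x => [|[m' r'] x] //= /andP[/andP[m'0 ax] lstx] wt.
  case: ifP => [r'0 /eqP[Em Er Ex]|r'0]; subst.
    rewrite prednK //.
    by case: (w) lstx => [|y w'] /=; rewrite ?mem_head ?orbT //; lia.
  have {r'0}-> : r' = 0 by lia.
  case: ifP => [m'1 /eqP[Em Er Ex]|m'1 /eqP Ex]; subst.
    by rewrite eqxx prednK ?mem_head ?orbT.
  have -> : m' = 1 by lia.
  by rewrite eqxx.
Qed.

Lemma mem_rev_codes n w : (w \in rev_codes n) = is_code (rev w) && (weight w == n).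
Proof.
elim: n w => [|n IH] w.
  rewrite inE; apply/eqP/andP=> [->//|[]].
  by rewrite is_code_rev; case: w => [|[m r] w] //=; rewrite /weight /=; lia.
apply/flatten_mapP/idP=> [[p pn]|/andP[cw /eqP wt]].
  move: pn; rewrite IH => /andP[cp /eqP wp]; rewrite mem_grow // wp.
  by case/and3P=> -> ->.
have cp : is_code (rev (parent w)) && (weight (parent w) == n).
  move: cw wt; rewrite !is_code_rev /weight; case: w => [|[m r] w] //=.
  case/andP=> /andP[m0 aw] lst wt.
  case: ifP => r0 /=; first by rewrite m0 aw; case: (w) lst wt => //=; lia.
  case: ifP => m1 /=; last by rewrite aw; case: (w) lst wt => //=; lia.
  by rewrite aw; case: (w) lst wt => //=; lia.
exists (parent w); first by rewrite IH.
by case/andP: cp => cp /eqP wp; rewrite mem_grow // cw wt wp !eqxx.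
Qed.

Lemma uniq_rev_codes n : uniq (rev_codes n).
Proof.
elim: n => // n IH /=.
have: {subset rev_codes n <= [pred w | is_code (rev w)]}.
  by move=> w; rewrite mem_rev_codes inE => /andP[].
elim: (rev_codes n) IH => //= w s IHs /andP[ws us] sub.
have cw : is_code (rev w) by apply: (sub w); rewrite mem_head.
have subs : {subset s <= [pred w | is_code (rev w)]}.
  by move=> x xs; apply: (sub x); rewrite inE xs orbT.
rewrite cat_uniq IHs // andbT; apply/andP; split.
  move: cw; rewrite is_code_rev.
  by case: (w) => [|[m r] [|y w']] //= /andP[/andP[m0 _] _];
    case: eqP => [->|] //=;
    rewrite !inE !eqseq_cons !xpair_eqE /=; lia.
apply/hasPn=> x /flatten_mapP[w' w's].
have cw' : is_code (rev w') by exact: subs w' w's.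
rewrite mem_grow //.
case/and3P=> _ _ /eqP xw'; rewrite /= mem_grow //.
by apply: contra ws => /and3P[_ _ /eqP<-]; rewrite xw'.
Qed.

(** Label (3) of the generating tree; the other nonempty codes have label (2). *)
Definition three_children (w : seq (nat * nat)) :=
  if w is (m, r) :: _ :: _ then r == 0 else false.

Lemma size_grow w : w != [::] -> is_code (rev w) ->
  size (grow w) = (three_children w).+2 /\
  count three_children (grow w) = (three_children w).+1.
Proof.
by rewrite is_code_rev; case: w => [|[m r] [|y w]] //= _ /andP[_]; case: (r == 0).
Qed.

Lemma size_flatten_grow s : all (fun w => (w != [::]) && is_code (rev w)) s ->
  size (flatten [seq grow w | w <- s]) = 2 * size s + count three_children s /\
  count three_children (flatten [seq grow w | w <- s]) = size s + count three_children s.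
Proof.
elim: s => //= w s IHs /andP[/andP[w0 cw] /IHs[E1 E2]].
have [G1 G2] := size_grow w0 cw.
by rewrite size_cat count_cat E1 E2 G1 G2; lia.
Qed.

(** The root, with its single child, does not follow the rule, so the induction starts at weight
    1. *)
Lemma size_rev_codes n : size (rev_codes n.+1) = fib (2 * n).+1 /\
  count three_children (rev_codes n.+1) = fib (2 * n).
Proof.
elim: n => // n [IH1 IH2].
have [|E1 E2] := @size_flatten_grow (rev_codes n.+1).
  by apply/allP=> w; rewrite mem_rev_codes; case: w => // x w /andP[-> _].
rewrite [rev_codes n.+2]/(flatten _) E1 E2 IH1 IH2 (_ : 2 * n.+1 = (2 * n).+2) /=; lia.
Qed.

(** * Codes and structured matrices *)

Section Cells.
Variable phi : nat * nat -> nat * nat * nat.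

(* The free parameters of row and column i; only those with 0 < i < K are         *)
(* constrained, and hence encoded through phi.                                    *)
Definition triple q i : nat * nat * nat :=
  let x := nth (0, 0) q i in if 0 < i < (size q).-1 then phi x else (x.1, 0, x.2).

(** For i = 0 the first and third slots name the same cell (0, 0), which is why the first pair of a
    code has r = 0. For i = K > 0 the third slot is the corner (0, K). *)
Definition block K i (z : nat * nat * nat) :=
  nseq z.1.1 (i, i) ++ nseq z.1.2 (i, K) ++ nseq z.2 (0, i).

Definition cells q :=
  sort lexle (flatten [seq block (size q).-1 i (triple q i) | i <- iota 0 (size q)]).

Lemma triple_default q i : size q <= i -> triple q i = (0, 0, 0).
Proof. by move=> le; rewrite /triple nth_default //; case: ifP => //; lia. Qed.

Lemma count_cells q i j : count_mem (i, j) (cells q) =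
  (i == j) * (triple q i).1.1 + (j == (size q).-1) * (triple q i).1.2 +
  (i == 0) * (triple q j).2.
Proof.
rewrite /cells (permP (permEl (perm_sort _ _))) count_flatten -map_comp sumnE big_map.
(* Each of the three kinds of entry comes from one block only; an index beyond the code contributes
   the default 0. *)
have pick (F : nat -> nat) l : (size q <= l -> F l = 0) ->
    \sum_(0 <= a < size q | a == l) F a = F l.
  by rewrite big_nat1_eq => F0; case: ltnP => // /F0.
have d0 l : size q <= l -> (triple q l).1.1 = 0 by move/triple_default->.
have e0 l : size q <= l -> (triple q l).1.2 = 0 by move/triple_default->.
have f0 l : size q <= l -> (triple q l).2 = 0 by move/triple_default->.
rewrite -(pick (fun a => (triple q a).1.1) _ (d0 i)).
rewrite -(pick (fun a => (triple q a).1.2) _ (e0 i)).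
rewrite -(pick (fun a => (triple q a).2) _ (f0 j)).
rewrite !big_distrr /= [X in _ = X + _ + _]big_mkcond.
rewrite [X in _ + X + _]big_mkcond [X in _ + X]big_mkcond /=.
rewrite -!big_split /= /index_iota subn0; apply: eq_bigr => a _.
rewrite /block !count_cat !count_nseq /= !xpair_eqE [0 == i]eq_sym [_ == j]eq_sym.
rewrite [(size q).-1 == j]eq_sym.
have [->|_] := eqVneq a i; rewrite ?[j == i]eq_sym.
  by case: (i == j); case: (j == _); case: (i == 0);
    rewrite /= ?mul1n ?mul0n ?addn0 ?add0n ?addnA.
by case: (j == a); case: (i == 0); rewrite /= ?mul1n ?mul0n ?addn0 ?add0n.
Qed.

(** [phi] and [psi] are inverse, weight-preserving bijections between pairs with m > 0 and triples
    allowed by T; [T_row] and [T_col] keep the rows and columns nonzero. *)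
Variables (T : nat -> nat -> nat -> bool) (psi : nat * nat * nat -> nat * nat).
Hypothesis phiT : forall x, 0 < x.1 -> T (phi x).1.1 (phi x).1.2 (phi x).2.
Hypothesis phiK : forall x, 0 < x.1 -> psi (phi x) = x.
Hypothesis phi_weight : forall x, 0 < x.1 ->
  (phi x).1.1 + (phi x).1.2 + (phi x).2 = x.1 + x.2.
Hypothesis psiK : forall z, T z.1.1 z.1.2 z.2 -> phi (psi z) = z.
Hypothesis psi_gt0 : forall z, T z.1.1 z.1.2 z.2 -> 0 < (psi z).1.
Hypothesis T_row : forall d e f, T d e f -> 0 < d + e.
Hypothesis T_col : forall d e f, T d e f -> 0 < d + f.

Lemma code_gt0 q i : is_code q -> i < size q -> 0 < (nth (0, 0) q i).1.
Proof. by case/andP=> /allP H _ lt; apply/H/mem_nth. Qed.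

Lemma triple_mid q i : 0 < i < (size q).-1 -> triple q i = phi (nth (0, 0) q i).
Proof. by move=> ik; rewrite /triple ik. Qed.

Lemma triple_end q i : ~~ (0 < i < (size q).-1) ->
  triple q i = ((nth (0, 0) q i).1, 0, (nth (0, 0) q i).2).
Proof. by move=> /negbTE ik; rewrite /triple ik. Qed.

Lemma size_cells q : is_code q -> size (cells q) = weight q.
Proof.
move=> cq; rewrite size_sort size_flatten /shape -map_comp /weight.
rewrite -[in RHS](mkseq_nth (0, 0) q) /mkseq -map_comp; congr sumn.
apply/eq_in_map => i; rewrite mem_iota /= add0n => lti.
rewrite /block !size_cat !size_nseq /triple addnA; case: ifP => _ /=; last by rewrite addn0.
by rewrite phi_weight // code_gt0.
Qed.

Lemma mem_cells q i j : (i, j) \in cells q <-> 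
  [\/ i = j /\ 0 < (triple q i).1.1, j = (size q).-1 /\ 0 < (triple q i).1.2 |
      i = 0 /\ 0 < (triple q j).2].
Proof.
rewrite -count_gt0 count_cells !addn_gt0 !muln_gt0 !lt0b.
split=> [|[[-> ->]|[-> ->]|[-> ->]]]; rewrite ?eqxx ?orbT //.
by case/orP=> [/orP[]|] /andP[/eqP-> ->]; [constructor 1|constructor 2|constructor 3].
Qed.

Lemma fishburn_cells q : is_code q -> fishburn (size q) (cells q).
Proof.
move=> cq; have gt0 := code_gt0 cq; have /andP[_ /eqP q0] := cq.
have lt_size i : triple q i <> (0, 0, 0) -> i < size q.
  by move=> H; rewrite ltnNge; apply/negP=> /triple_default.
split.
- exact: sort_sorted lexle_total _.
- move=> [i j] /mem_cells[[<- d]|[-> e]|[-> f]] /=.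
  + by rewrite leqnn lt_size // => E; rewrite E in d.
  + by have : i < size q; [apply: lt_size => E; rewrite E in e|lia].
  + by rewrite lt_size // => E; rewrite E in f.
- move=> v ltv; have [mid|/negP mid] := boolP (0 < v < (size q).-1); last first.
    by exists v; apply/mem_cells; constructor 1; rewrite triple_end ?gt0 //; apply/negP.
  have := T_row (phiT (gt0 v ltv)); rewrite -triple_mid // addn_gt0.
  by case/orP=> H; [exists v | exists (size q).-1]; apply/mem_cells;
    [constructor 1 | constructor 2].
- move=> v ltv; have [mid|/negP mid] := boolP (0 < v < (size q).-1); last first.
    by exists v; apply/mem_cells; constructor 1; rewrite triple_end ?gt0 //; apply/negP.
  have := T_col (phiT (gt0 v ltv)); rewrite -triple_mid // addn_gt0.
  by case/orP=> H; [exists v | exists 0]; apply/mem_cells; [constructor 1 | constructor 3].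
Qed.

Lemma structured_cells q : is_code q -> structured T (size q) (cells q).
Proof.
move=> cq; split=> [i j /mem_cells[[-> _]|[-> _]|[-> _]]|i ik]; rewrite ?eqxx ?orbT //.
rewrite !count_cells !eqxx (triple_mid ik).
have -> : (i == (size q).-1) = false by lia.
have -> : (i == 0) = false by lia.
have -> : (0 == i) = false by lia.
by rewrite !mul0n !mul1n !addn0 !add0n phiT // code_gt0 //; lia.
Qed.

Definition decode k (c : seq (nat * nat)) :=
  mkseq (fun i => if 0 < i < k.-1 then
      psi (count_mem (i, i) c, count_mem (i, k.-1) c, count_mem (0, i) c)
    else (count_mem (i, i) c, if i == 0 then 0 else count_mem (0, i) c)) k.

Lemma is_code_decode k c : fishburn k c -> structured T k c -> is_code (decode k c).
Proof.
move=> fc [str1 str2]; apply/andP; split; last first.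
  by case: k {fc str1 str2} => [|k] //.
apply/allP=> x /mapP[i]; rewrite mem_iota /= add0n => lti ->.
case: ifP => [/str2 Ti|/negbT mid] /=; first exact: psi_gt0.
rewrite count_gt0; have [i0|i0] := posnP i.
  have [y yi] := fishburn_col fc lti; have /= := fishburn_upper fc yi.
  by rewrite i0 leqn0 => /andP[/eqP E _]; move: yi; rewrite E i0.
have [j ij] := fishburn_row fc lti; have /= := fishburn_upper fc ij => le.
have E : j = i by lia.
by move: ij; rewrite E.
Qed.

Lemma triple_decode k c i : structured T k c -> triple (decode k c) i =
  if i < k then (count_mem (i, i) c, if 0 < i < k.-1 then count_mem (i, k.-1) c else 0,
                 if i == 0 then 0 else count_mem (0, i) c)
  else (0, 0, 0).
Proof.
move=> [_ str2]; have [lti|lei] := ltnP i k; last by rewrite triple_default ?size_mkseq.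
rewrite /triple size_mkseq nth_mkseq //=; case: ifP => ik; rewrite ?ik //.
by rewrite psiK ?str2 //; case/andP: ik; case: (i).
Qed.

Lemma cells_decode k c : fishburn k c -> structured T k c -> cells (decode k c) = c.
Proof.
move=> fc str; have /= up := fishburn_upper fc.
apply: (sorted_eq lexle_trans lexle_anti).
- exact: sort_sorted lexle_total _.
- exact: fishburn_sorted fc.
apply/allP=> -[i j] _; apply/eqP; rewrite /= count_cells !triple_decode // size_mkseq.
have up0 a b : ~~ (a <= b < k) -> count_mem (a, b) c = 0.
  by move=> le; apply/count_memPn; apply: contra le => /up.
have str0 a b : ~~ [|| a == 0, b == a | b == k.-1] -> count_mem (a, b) c = 0.
  by move=> ns; apply/count_memPn; apply: contra ns => /str.1.
have [k0|k_gt0] := posnP k; first by rewrite k0 !muln0 up0 // k0 andbF.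
have [lt_j|ge_j] := ltnP j k; last first.
  have jk : (j == k.-1) = false by lia.
  have -> : count_mem (i, j) c = 0 by apply: up0; lia.
  rewrite jk muln0 addn0.
  case: ltnP => [lt_i|_]; rewrite ?muln0 //.
  by have -> : (i == j) = false by lia.
have [lt_i|ge_i] := ltnP i k => /=; last first.
  have -> : (i == 0) = false by lia.
  have -> : count_mem (i, j) c = 0 by apply: up0; lia.
  by rewrite !muln0.
have [->|nij] := eqVneq i j.
  rewrite mul1n; have [->|j0] := eqVneq j 0; first by rewrite ltnn /= !muln0 !addn0.
  have [->|jk] := eqVneq j k.-1; first by rewrite ltnn andbF muln0 !addn0.
  by rewrite !mul0n !addn0.
rewrite mul0n add0n; have [i0|i0] := eqVneq i 0.
  rewrite i0 ltnn /= muln0 mul1n; case: eqP => // j0.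
  by rewrite i0 j0 eqxx in nij.
rewrite mul0n addn0; have [jk|jk] := eqVneq j k.-1.
  by rewrite mul1n -jk ifT //; lia.
rewrite mul0n [RHS]str0 //.
by rewrite (negbTE i0) (negbTE jk) eq_sym (negbTE nij).
Qed.

Lemma cells_inj q q' : is_code q -> is_code q' -> cells q = cells q' -> q = q'.
Proof.
move=> cq cq' E; have fc := fishburn_cells cq; have fc' := fishburn_cells cq'.
(* The larger size would force a nonzero row at an index that the smaller one excludes. *)
have szE : size q = size q'.
  rewrite E in fc; case: (ltngtP (size q) (size q')) => // lt.
    have [j ij] := fishburn_row fc' lt; have /= := fishburn_upper fc ij; lia.
  by have [j ij] := fishburn_row fc lt; have /= := fishburn_upper fc' ij; lia.
have /andP[_ /eqP q0] := cq; have /andP[_ /eqP q'0] := cq'.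
apply: (@eq_from_nth _ (0, 0)) => // i lti; have lti' := lti; rewrite szE in lti'.
have cE a b : count_mem (a, b) (cells q) = count_mem (a, b) (cells q') by rewrite E.
have [mid|/negP/negP mid] := boolP (0 < i < (size q).-1).
  have mid' := mid; rewrite szE in mid'.
  have [H1 H2 H3] : [/\ (i == (size q).-1) = false, (i == 0) = false & (0 == i) = false].
    by split; lia.
  have H1' : (i == (size q').-1) = false by rewrite -szE.
  have: triple q i = triple q' i.
    move: (cE i i) (cE i (size q).-1) (cE 0 i).
    rewrite !count_cells szE !eqxx H2 H3 H1' !mul0n !mul1n !addn0 !add0n.
    by case: (triple q i) (triple q' i) => [[d e] f] [[d' e'] f'] /= -> -> ->.
  rewrite !triple_mid // => /(congr1 psi).
  by rewrite !phiK ?code_gt0.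
have mid' := mid; rewrite szE in mid'.
move: (cE i i) (cE 0 i); rewrite !count_cells !(triple_end mid) !(triple_end mid') /= !muln0.
rewrite !addn0 !eqxx !mul1n; have [i0|i0] := eqVneq i 0.
  rewrite i0 q0 q'0 !muln0 !addn0 => H _.
  by case: (nth _ q 0) (nth _ q' 0) H q0 q'0 => [a b] [a' b'] /= -> -> ->.
rewrite !mul0n !addn0 !add0n.
by case: (nth _ q i) (nth _ q' i) => [a b] [a' b'] /= -> ->.
Qed.

Lemma structured_codeP k c : fishburn k c -> structured T k c ->
  exists q, [/\ is_code q, size q = k & c = cells q].
Proof.
move=> fc str; exists (decode k c).
by rewrite is_code_decode // size_mkseq cells_decode.
Qed.

(** Sends a code to its matrix and then to its diagram. Only [phi], [psi] and the description of the
    avoiders depend on the pair of patterns. *)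
Lemma card_avoiders n (P P' : {set {set 'I_4.*2}}) :
  (forall k c, size c = n -> fishburn k c ->
     ~~ contains (diagram n c) P /\ ~~ contains (diagram n c) P' <-> structured T k c) ->
  #|avoiders [set P; P'] n| = size (rev_codes n).
Proof.
move=> char.
have avE M : (M \in avoiders [set P; P'] n) =
    stoimenow M && (~~ contains M P && ~~ contains M P').
  rewrite inE; congr andb; apply/forall_inP/andP=> [av|[avP avP'] Q].
    by rewrite !av // !inE eqxx ?orbT.
  by rewrite !inE => /orP[]/eqP->.
have codeP w : w \in rev_codes n -> is_code (rev w) /\ size (cells (rev w)) = n.
  rewrite mem_rev_codes => /andP[cw /eqP wt]; split=> //.
  by rewrite size_cells // weight_rev.
have /eq_card-> : avoiders [set P; P'] n =i
    [seq diagram n (cells (rev w)) | w <- rev_codes n].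
  move=> M; rewrite avE; apply/idP/mapP=> [/andP[sM avM]|[w /codeP[cw sz] ->]]; last first.
    have fc := fishburn_cells cw.
    rewrite (stoimenow_diagram sz fc) /=; apply/andP; apply/(char _ _ sz fc).
    exact: structured_cells.
  have [k [c [sz fc ME]]] := diagram_surj sM; subst M.
  have str : structured T k c by apply/(char _ _ sz fc)/andP.
  have [q [cq szq cE]] := structured_codeP fc str.
  exists (rev q); last by rewrite revK -cE.
  by rewrite mem_rev_codes revK cq weight_rev -size_cells // -cE sz eqxx.
rewrite -(size_map (fun w => diagram n (cells (rev w)))).
apply/card_uniqP; rewrite map_inj_in_uniq ?uniq_rev_codes //.
move=> w w' /codeP[cw sz] /codeP[cw' sz'].
move/(diagram_inj sz sz' (fishburn_cells cw) (fishburn_cells cw'))/(cells_inj cw cw').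
exact: (can_inj revK).
Qed.
End Cells.

(** * Reversal *)

Section Reversal.
Variable n : nat.
Implicit Types M : {set {set 'I_n.*2}}.

Definition rev_arcs M : {set {set 'I_n.*2}} :=
  [set @rev_ord n.*2 @: (B : {set _}) | B in M].

Lemma rev_arcsK : involutive rev_arcs.
Proof.
move=> M; rewrite /rev_arcs -imset_comp -[RHS]imset_id; apply: eq_imset => B /=.
by rewrite -imset_comp -[RHS]imset_id; apply: eq_imset => x /=; rewrite rev_ordK.
Qed.

Lemma mem_rev_arcs M x y : ([set x; y] \in rev_arcs M) = ([set rev_ord x; rev_ord y] \in M).
Proof.
have -> : [set x; y] = @rev_ord n.*2 @: [set rev_ord x; rev_ord y].
  by rewrite imsetU !imset_set1 !rev_ordK.
by rewrite mem_imset //; apply/imset_inj/rev_ord_inj.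
Qed.

Lemma is_arc_rev M x y : is_arc (rev_arcs M) x y = is_arc M (rev_ord y) (rev_ord x).
Proof.
rewrite /is_arc mem_rev_arcs setUC; congr andb => /=.
by have := ltn_ord x; have := ltn_ord y; lia.
Qed.

Lemma is_matching_rev M : is_matching M -> is_matching (rev_arcs M).
Proof.
case/andP=> pM /forall_inP cM; apply/andP; split.
  have -> : [set: 'I_n.*2] = @rev_ord n.*2 @: [set: 'I_n.*2].
    by apply/setP=> x; rewrite -[x]rev_ordK !inE mem_imset ?inE //; apply: rev_ord_inj.
  by rewrite (imset_partition _ _ rev_ord_inj).
apply/forall_inP=> _ /imsetP[B BM ->]; rewrite card_imset; first exact: cM.
exact: rev_ord_inj.
Qed.

(** Reversal exchanges Type 1 and Type 2. *)
Lemma stoimenow_rev M : stoimenow M -> stoimenow (rev_arcs M).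
Proof.
case/and3P=> mM N1 N2; apply/and3P; split; first exact: is_matching_rev.
- apply: contra N2 => /existsP[i /existsP[i1 /existsP[x /existsP[l]]]].
  rewrite !is_arc_rev => /and4P[/eqP E /andP[lt1 lt2] A1 A2].
  apply/existsP; exists (rev_ord l); apply/existsP; exists (rev_ord x).
  apply/existsP; exists (rev_ord i1); apply/existsP; exists (rev_ord i).
  rewrite A1 A2 !andbT /=; have := ltn_ord i1; have := ltn_ord l; have := ltn_ord x; lia.
- apply: contra N1 => /existsP[x /existsP[l /existsP[j /existsP[j1]]]].
  rewrite !is_arc_rev => /and4P[/eqP E /andP[lt1 lt2] A1 A2].
  apply/existsP; exists (rev_ord j1); apply/existsP; exists (rev_ord j).
  apply/existsP; exists (rev_ord l); apply/existsP; exists (rev_ord x).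
  rewrite A1 A2 !andbT /=; have := ltn_ord j1; have := ltn_ord l; have := ltn_ord x; lia.
Qed.

Lemma contains_rev M s s' : arcs4 s -> arcs4 s' ->
  {in s', forall p, (9 - p.2, 9 - p.1) \in s} ->
  contains M (of_arcs 4 s) -> contains (rev_arcs M) (of_arcs 4 s').
Proof.
move=> ws ws' ss' /(contains_of_arcs _ ws)[x [inc mem]].
(* Label a becomes 9 - a, hence index i becomes 7 - i. *)
apply/(contains_of_arcs _ ws'); exists (fun i => rev_ord (x (7 - i))); split.
  move=> i j ij; have := inc (7 - j) (7 - i); have := ltn_ord (x (7 - i)) => /=; lia.
move=> [a b] ps; rewrite mem_rev_arcs !rev_ordK setUC /=.
have /and3P[/allP /(_ _ ps) /= wp _ _] := ws'.
have := mem _ (ss' _ ps) => /=.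
have -> : 7 - b.-1 = (9 - b).-1 by lia.
by have -> : 7 - a.-1 = (9 - a).-1 by lia.
Qed.

End Reversal.

Lemma card_avoiders_rev n (S S' : {set {set {set 'I_4.*2}}}) :
  (forall M : {set {set 'I_n.*2}}, {in S', forall P, contains M P ->
     exists2 Q, Q \in S & contains (rev_arcs M) Q}) ->
  (forall M : {set {set 'I_n.*2}}, {in S, forall P, contains M P ->
     exists2 Q, Q \in S' & contains (rev_arcs M) Q}) ->
  #|avoiders S n| = #|avoiders S' n|.
Proof.
move=> SS' S'S; rewrite -(card_imset _ (inv_inj (@rev_arcsK n))).
apply: eq_card => M; apply/imsetP/idP=> [[N]|].
  rewrite !inE => /andP[sN /forall_inP av] ->; rewrite stoimenow_rev //=.
  apply/forall_inP=> P /SS' H; apply/negP=> /H[Q /av/negP nQ].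
  by rewrite rev_arcsK.
rewrite inE => /andP[sM /forall_inP av]; exists (rev_arcs M); last by rewrite rev_arcsK.
rewrite inE stoimenow_rev //=; apply/forall_inP=> P /S'S H; apply/negP=> /H[Q /av/negP nQ].
by rewrite rev_arcsK.
Qed.

(** * The five pairs of patterns *)

Lemma card_avoiders_P2P4 n : #|avoiders [set P2; P4] n| = size (rev_codes n).
Proof.
apply: (@card_avoiders (fun x => (x.1, 0, x.2)) triple_P2P4 (fun z => (z.1.1, z.2))).
- by move=> [m r] /= m0; rewrite /triple_P2P4 m0.
- by case.
- by move=> [m r] /= _; rewrite addn0.
- by move=> [[d e] f] /andP[_ /eqP /= ->].
- by move=> [[d e] f] /andP[].
- by move=> d e f /andP[d0 _]; rewrite addn_gt0 d0.
- by move=> d e f /andP[d0 _]; rewrite addn_gt0 d0.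
- by move=> k c sz fc; apply: avoid_P2P4.
Qed.

Lemma card_avoiders_P3P4 n : #|avoiders [set P3; P4] n| = size (rev_codes n).
Proof.
(* For m > 1 one unit moves from m to r, so that e = m - 1 and f = r + 1 are both positive. *)
apply: (@card_avoiders (fun x => if x.1 == 1 then (1, 0, x.2) else (0, x.1.-1, x.2.+1))
  triple_P3P4 (fun z => if z.1.1 == 1 then (1, z.2) else (z.1.2.+1, z.2.-1))).
- by move=> [m r] /= m0; case: eqP => //= m1; rewrite /triple_P3P4 /=; lia.
- by move=> [[|[|m]] r].
- by move=> [[|[|m]] r] //= _; lia.
- by move=> [[[|[|d]] [|e]] [|f]].
- by move=> [[[|[|d]] [|e]] [|f]].
- by move=> [|[|d]] [|e] [|f].
- by move=> [|[|d]] [|e] [|f].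
- by move=> k c sz fc; apply: avoid_P3P4.
Qed.

Lemma card_avoiders_P4P5 n : #|avoiders [set P4; P5] n| = size (rev_codes n).
Proof.
(* Whether r vanishes decides between the two alternatives for the triple. *)
apply: (@card_avoiders (fun x => if x.2 == 0 then (x.1, 0, 0) else (0, x.1, x.2))
  triple_P4P5 (fun z => if z.1.1 == 0 then (z.1.2, z.2) else (z.1.1, 0))).
- by move=> [[|m] [|r]].
- by move=> [[|m] [|r]].
- by move=> [[|m] [|r]] //= _; lia.
- by move=> [[[|d] [|e]] [|f]].
- by move=> [[[|d] [|e]] [|f]].
- by move=> [|d] [|e] [|f].
- by move=> [|d] [|e] [|f].
- by move=> k c sz fc; apply: avoid_P4P5.
Qed.

Lemma contains_rev_P2 n (M : {set {set 'I_n.*2}}) :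
  contains M P2 -> contains (rev_arcs M) P2.
Proof. by apply: contains_rev => //; apply/allP. Qed.

Lemma contains_rev_P3 n (M : {set {set 'I_n.*2}}) :
  contains M P3 -> contains (rev_arcs M) P3.
Proof. by apply: contains_rev => //; apply/allP. Qed.

Lemma contains_rev_P4 n (M : {set {set 'I_n.*2}}) :
  contains M P4 -> contains (rev_arcs M) P5.
Proof. by apply: contains_rev => //; apply/allP. Qed.

Lemma contains_rev_P5 n (M : {set {set 'I_n.*2}}) :
  contains M P5 -> contains (rev_arcs M) P4.
Proof. by apply: contains_rev => //; apply/allP. Qed.

Lemma card_avoiders_P2P5 n : #|avoiders [set P2; P5] n| = size (rev_codes n).
Proof.
rewrite -card_avoiders_P2P4; apply: card_avoiders_rev => M P; rewrite !inE.
- case/orP=> /eqP-> cM; first by exists P2; [rewrite set21 | apply: contains_rev_P2].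
  by exists P5; [rewrite set22 | apply: contains_rev_P4].
- case/orP=> /eqP-> cM; first by exists P2; [rewrite set21 | apply: contains_rev_P2].
  by exists P4; [rewrite set22 | apply: contains_rev_P5].
Qed.

Lemma card_avoiders_P3P5 n : #|avoiders [set P3; P5] n| = size (rev_codes n).
Proof.
rewrite -card_avoiders_P3P4; apply: card_avoiders_rev => M P; rewrite !inE.
- case/orP=> /eqP-> cM; first by exists P3; [rewrite set21 | apply: contains_rev_P3].
  by exists P5; [rewrite set22 | apply: contains_rev_P4].
- case/orP=> /eqP-> cM; first by exists P3; [rewrite set21 | apply: contains_rev_P3].
  by exists P4; [rewrite set22 | apply: contains_rev_P5].
Qed.

(** * Generating function and conclusion *)

Import GRing.Theory.
Local Open Scope ring_scope.

Lemma fibSS m : fib m.+2 = (fib m.+1 + fib m)%N. Proof. by []. Qed.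

Arguments rev_codes : simpl never.

Lemma fps_rev_codes : (fun n => (size (rev_codes n))%:R : int) =1
  fps_div (fps_of_poly (1 - 2 * 'X : {poly int}))
          (fps_of_poly (1 - 3 * 'X + 'X^2 : {poly int})).
Proof.
have coefq i : fps_of_poly (1 - 3 * 'X + 'X^2 : {poly int}) i =
    (i == 0)%:R - 3 * (i == 1)%:R + (i == 2)%:R.
  by rewrite /fps_of_poly coefD coefB -polyC_natr coefCM coef1 coefX coefXn.
have coefp i : fps_of_poly (1 - 2 * 'X : {poly int}) i = (i == 0)%:R - 2 * (i == 1)%:R.
  by rewrite /fps_of_poly coefB -polyC_natr coefCM coef1 coefX.
apply/fps_divP; first by rewrite coefq.
move=> n; rewrite /fps_mul coefp.
under eq_bigr => i _ do rewrite coefq.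
case: n => [|[|n]].
- by rewrite big_ord1.
- by rewrite !big_ord_recr big_ord0.
rewrite !big_ord_recr /= !subnn.
rewrite (_ : (n.+2 - n = 2)%N); last by lia.
rewrite (_ : (n.+2 - n.+1 = 1)%N); last by lia.
(* The denominator has degree 2, so only the last three terms of the convolution survive. *)
rewrite big1 ?add0r /=; last first.
  move=> i _; have := ltn_ord i => lti.
  have [-> -> ->] : [/\ (n.+2 - i == 0)%N = false, (n.+2 - i == 1)%N = false &
    (n.+2 - i == 2)%N = false] by split; lia.
  by rewrite /= !(mulr0, subr0, addr0).
have sz m : size (rev_codes m.+1) = fib (2 * m).+1 by case: (size_rev_codes m).
(* The coefficient of x^2 involves the empty code, outside the Fibonacci formula, and is computed.
   Beyond it the claim is F_{2n+5} - 3 F_{2n+3} + F_{2n+1} = 0. *)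
case: n => [//|n]; rewrite !sz.
have [-> ->] : (2 * n.+2)%N = (2 * n).+4 /\ (2 * n.+1)%N = (2 * n).+2 by lia.
rewrite !fibSS; move: (fib (2 * n)) (fib (2 * n).+1) => a b; clear.
by lia.
Qed.

Theorem theorem3p4 (S : {set {set {set 'I_4.*2}}})
  (hS : S \in [:: [set P2; P4]; [set P2; P5]; [set P3; P4];
                  [set P3; P5]; [set P4; P5]]) :
  ((fun n : nat => #|avoiders S n|%:R : int) =1
     fps_div (fps_of_poly (1 - 2 * 'X : {poly int}))
             (fps_of_poly (1 - 3 * 'X + 'X^2 : {poly int})))
  /\ (forall n : nat, (1 <= n)%N -> #|avoiders S n| = fib (2 * n - 1)%N).
Proof.
have card_S n : #|avoiders S n| = size (rev_codes n).
  move: hS; rewrite !inE => /or4P[|||/orP[]] /eqP->.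
  - exact: card_avoiders_P2P4.
  - exact: card_avoiders_P2P5.
  - exact: card_avoiders_P3P4.
  - exact: card_avoiders_P3P5.
  - exact: card_avoiders_P4P5.
split=> [n|[//|n] _]; first by rewrite card_S fps_rev_codes.
rewrite card_S (size_rev_codes n).1; congr fib; lia.
Qed.
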